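(* Let $\mathcal{D}_F$ be the domain of the Friedrichs extension of $A_c$. Let $\mathcal{D}$ be the domain of a selfadjoint extension of $A_c$, i.e. $\mathcal{D}=D+\mathcal{D}_{\min}$ with $D\in\mathfrak{SA}$. Then $\mathcal{D}$ is spectrally unstable if and only if $(\mathcal{D}\cap\mathcal{D}_F)/\mathcal{D}_{\min}\neq 0$.
   Context: Setting: $H$ is a separable (complex) Hilbert space with inner product $(\cdot,\cdot)$, and $A_c:\mathcal{D}_c\subset H\to H$ is a densely defined unbounded symmetric operator bounded from below (there is $m\in\mathbb{R}$ with $(A_cu,u)\ge m\|u\|^2$ for $u\in\mathcal{D}_c$). $A:\mathcal{D}_{\max}\subset H\to H$ is the adjoint of $A_c$ (an extension of $A_c$). $\mathcal{D}_{\max}$ is a Hilbert space with inner product $(u,v)_A=(Au,Av)+(u,v)$. $\mathcal{D}_{\min}$ is the domain of the closure of $A_c$ (the closure of $\mathcal{D}_c$ in $\mathcal{D}_{\max}$). It is assumed that the inclusion $\mathcal{D}_{\max}\hookrightarrow H$ is compact and that $\mathcal{D}_{\min}$ has finite positive codimension in $\mathcal{D}_{\max}$. For a subspace $\mathcal{D}$ with $\mathcal{D}_{\min}\subset\mathcal{D}\subset\mathcal{D}_{\max}$, $A_{\mathcal{D}}$ denotes $A$ with domain $\mathcal{D}$. $\mathcal{E}$ is the orthogonal complement of $\mathcal{D}_{\min}$ in $\mathcal{D}_{\max}$ with respect to $(\cdot,\cdot)_A$; its dimension is $2d$ where $d=-\operatorname{ind}A_{\mathcal{D}_{\min}}>0$.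 Domains of closed extensions are exactly $\mathcal{D}=D+\mathcal{D}_{\min}$ with $D\subset\mathcal{E}$ a subspace. $\mathrm{Gr}_d(\mathcal{E})$ is the Grassmannian of $d$-dimensional subspaces of $\mathcal{E}$ with its usual topology, and $\mathfrak{SA}\subset\mathrm{Gr}_d(\mathcal{E})$ (with the subspace topology) is the set of $D\subset\mathcal{E}$ such that $A$ with domain $D+\mathcal{D}_{\min}$ is selfadjoint. One identifies $D\in\mathfrak{SA}$ with the domain $D+\mathcal{D}_{\min}$. A selfadjoint domain $\mathcal{D}_0=D_0+\mathcal{D}_{\min}$ ($D_0\in\mathfrak{SA}$) is called spectrally unstable if for every neighborhood $U$ of $D_0$ in $\mathfrak{SA}$ and every $\zeta\in\mathbb{R}$ there is $D\in U$ such that $\operatorname{spec}(A_{D+\mathcal{D}_{\min}})\cap(-\infty,\zeta)\neq\emptyset$. *)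

(* Defs.v *)
From HB Require Import structures.
From mathcomp Require Import all_boot all_order all_algebra.
From mathcomp Require Import all_classical all_reals all_analysis.
From mathcomp Require Import complex.

Set Implicit Arguments.
Unset Strict Implicit.
Unset Printing Implicit Defensive.

Import Order.TTheory GRing.Theory Num.Theory.
Import numFieldNormedType.Exports.

Local Open Scope classical_set_scope.
Local Open Scope ring_scope.
Local Open Scope complex_scope.

Section LinearAlgebra.
Context {R : realType} {H : lmodType R[i]}.
Implicit Types V W : set H.

Definition linear_subspace V : Prop :=
  V 0 /\ forall (a : R[i]) u v, V u -> V v -> V (a *: u + v).

Definition add_space V W : set H := [set u + v | u in V & v in W].

Definition fam_span (n : nat) (f : 'I_n -> H) : set H :=
  [set \sum_(i < n) a i *: f i | a in [set: 'I_n -> R[i]]].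

Definition free_mod W (n : nat) (f : 'I_n -> H) : Prop :=
  forall a : 'I_n -> R[i],
    W (\sum_(i < n) a i *: f i) -> forall i, a i = 0.

(* dim (V / W) = n, for subspaces W of V; W = 0 gives dim V = n. *)
Definition quotient_dim V W (n : nat) : Prop :=
  exists f : 'I_n -> H,
    [/\ forall i, V (f i), free_mod W f & V = add_space W (fam_span f)].

(* The operator with domain V acting as T has index dim ker - dim coker = k. *)
Definition has_index V (T : H -> H) (k : int) : Prop :=
  exists n c : nat,
    [/\ quotient_dim (V `&` [set u | T u = 0]) [set 0] n,
        quotient_dim setT (T @` V) c & k = n%:Z - c%:Z].

End LinearAlgebra.

(* An unbounded operator is a pair of a domain V : set H and a total function
   T : H -> H whose values outside V are irrelevant. *)
Section UnboundedOperators.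
Context {R : realType} {H : completeNormedModType R[i]}.
Variable dot : {dot H for Num.conj}.
Implicit Types (V : set H) (T : H -> H).

Definition linear_on V T : Prop :=
  forall (a : R[i]) u v, V u -> V v -> T (a *: u + v) = a *: T u + T v.

Definition symmetric_on V T : Prop :=
  forall u v, V u -> V v -> dot (T u) v = dot u (T v).

Definition bounded_below V T (m : R) : Prop :=
  forall u, V u -> m%:C * `|u| ^+ 2 <= dot (T u) u.

Definition op_graph V T : set (H * H)%type :=
  [set p | V p.1 /\ p.2 = T p.1].

Definition adj_graph V T : set (H * H)%type :=
  [set p | forall u, V u -> dot (T u) p.1 = dot u p.2].

Definition selfadjoint V T : Prop :=
  dense V /\ adj_graph V T = op_graph V T.

Definition resolvent_set V T : set R[i] :=
  [set l | (forall w, exists! u, V u /\ T u - l *: u = w) /\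
           exists M : R[i], forall u, V u -> `|u| <= M * `|T u - l *: u|].

Definition spec V T : set R[i] := ~` resolvent_set V T.

End UnboundedOperators.

Section Extensions.
Context {R : realType} {H : completeNormedModType R[i]}.
Variables (dot : {dot H for Num.conj}) (Dc : set H) (Ac : H -> H).

Definition Dmax : set H := [set v | exists w, adj_graph dot Dc Ac (v, w)].

(* The adjoint of Ac: on Dmax the value is unique when Dc is dense. *)
Definition Amax (v : H) : H := xget 0 [set w | adj_graph dot Dc Ac (v, w)].

Definition dotA (u v : H) : R[i] := dot (Amax u) (Amax v) + dot u v.

Definition normA (u : H) : R[i] := sqrtC (dotA u u).

Definition Dmin : set H := [set u | exists w, closure (op_graph Dc Ac) (u, w)].

Definition compact_inclusion : Prop :=
  precompact [set u | Dmax u /\ normA u <= 1].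

Definition defect_space : set H :=
  [set u | Dmax u /\ forall v, Dmin v -> dotA u v = 0].

(* Domain of the Friedrichs extension: Dmax intersected with the form domain,
   the latter being the completion of Dc for the form norm
   (Ac u, u) + (1 - m) |u|^2, realized inside H. *)
Definition form_sqnorm (m : R) (u : H) : R[i] :=
  dot (Ac u) u + (1 - m%:C) * `|u| ^+ 2.

Definition friedrichs_form_dom (m : R) : set H :=
  [set u | exists u_ : nat -> H,
     [/\ forall n, Dc (u_ n),
         forall e : R[i], 0 < e -> exists N : nat, forall j k : nat,
           (N <= j)%N -> (N <= k)%N -> form_sqnorm m (u_ j - u_ k) < e
       & u_ @ \oo --> u]].

Definition friedrichs_dom (m : R) : set H := Dmax `&` friedrichs_form_dom m.

Variable d : nat.

Definition Gr : set (set H) :=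
  [set D | [/\ linear_subspace D, D `<=` defect_space & quotient_dim D [set 0] d]].

Definition frame (f : 'I_d -> H) : Prop :=
  (forall i, defect_space (f i)) /\ free_mod [set 0] f.

(* Quotient topology on the Grassmannian, induced by the map sending a
   linearly independent d-tuple of elements of the defect space to its span. *)
Definition Gr_open (O : set (set H)) : Prop :=
  O `<=` Gr /\
  forall f, frame f -> O (fam_span f) ->
    exists2 e : R[i], 0 < e &
      forall g, frame g -> (forall i, normA (g i - f i) < e) ->
        O (fam_span g).

Definition SA : set (set H) :=
  [set D | Gr D /\ selfadjoint dot (add_space D Dmin) Amax].

Definition SA_nbhs (D0 : set H) (U : set (set H)) : Prop :=
  U `<=` SA /\ exists2 O, Gr_open O & O D0 /\ O `&` SA `<=` U.

Definition spectrally_unstable (D0 : set H) : Prop :=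
  forall U, SA_nbhs D0 U -> forall zeta : R,
    exists2 D, U D &
      spec (add_space D Dmin) Amax `&` [set l%:C | l in [set l : R | l < zeta]]
        !=set0.

End Extensions.

(* Main.v *)
Require Import Defs.
From HB Require Import structures.
From mathcomp Require Import all_boot all_order all_algebra.
From mathcomp Require Import all_classical all_reals all_analysis.
From mathcomp Require Import complex lra ring.
Set Implicit Arguments.
Unset Strict Implicit.
Unset Printing Implicit Defensive.
Import Order.TTheory GRing.Theory Num.Theory.
Import numFieldNormedType.Exports.
Local Open Scope classical_set_scope.
Local Open Scope ring_scope.
Local Open Scope complex_scope.

(** Work with the graphs [G] of the adjoint and [G0] of the closure inside
    [H * H], where self-adjoint domains are the Lagrangian subspaces of the
    boundary form [bform p q = (A u, v) - (u, A v)] on [G / G0].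

    Both directions rest on one estimate ([low_energy_form_dom]). For [e] in the
    domain of the adjoint and [w] in [Dmin], [(A (e + w), e + w)] equals
    [(A w, w) + 2 Re (A e, w) + (A e, e)]. If it is at most [- T |e + w|^2] with
    [T -> +oo] while [e] stays bounded in graph norm, then [e + w -> 0] and the
    form of [w] stays bounded; hence every limit of the [e]'s lies in the form
    domain. Bounded subsets of the defect space have cluster points, because it
    is invariant under the adjoint and the inclusion of [Dmax] is compact.

    If [D] meets the Friedrichs domain only in [Dmin], the estimate forces a
    common lower bound for all domains close to [D]. Conversely, it shows that
    the eigenspaces [ker (A - l)] can only cluster inside the Friedrichs domain
    as [l -> -oo]; being Lagrangian, they then approximate each of its elements
    modulo [Dmin]. Given [e0] in [D] and the Friedrichs domain and such an
    eigenvector [k] close to [e0], an explicit near-identity map sends [e0] to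
    [k] and [D] to a Lagrangian subspace having [k] in its domain. *)

(** * Real and imaginary parts and the modulus of complex numbers *)

Section ComplexParts.
Context {R : realType}.
Implicit Types (x y : R[i]) (s t : R).

Lemma cReD x y : complex.Re (x + y) = complex.Re x + complex.Re y.
Proof. by case: x y => ? ? [? ?]. Qed.

Lemma cImD x y : complex.Im (x + y) = complex.Im x + complex.Im y.
Proof. by case: x y => ? ? [? ?]. Qed.

Lemma cReN x : complex.Re (- x) = - complex.Re x.
Proof. by case: x. Qed.

Lemma cImN x : complex.Im (- x) = - complex.Im x.
Proof. by case: x. Qed.

Lemma cReB x y : complex.Re (x - y) = complex.Re x - complex.Re y.
Proof. by rewrite cReD cReN. Qed.

Lemma cReM x y : complex.Re (x * y) =
  complex.Re x * complex.Re y - complex.Im x * complex.Im y.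
Proof. by case: x y => ? ? [? ?]. Qed.

Lemma cImM x y : complex.Im (x * y) =
  complex.Re x * complex.Im y + complex.Im x * complex.Re y.
Proof. by case: x y => ? ? [? ?]. Qed.

Lemma cRe_conj x : complex.Re (Num.conj x) = complex.Re x.
Proof. by case: x. Qed.

Lemma cIm_conj x : complex.Im (Num.conj x) = - complex.Im x.
Proof. by case: x. Qed.

Lemma complex_eqP x y :
  complex.Re x = complex.Re y -> complex.Im x = complex.Im y -> x = y.
Proof. by case: x y => ? ? [? ?] /= -> ->. Qed.

Lemma conj_realC t : Num.conj t%:C = t%:C.
Proof. by apply: complex_eqP => /=; rewrite ?oppr0. Qed.

Lemma ge0_Re x : 0 <= x -> (complex.Re x)%:C = x.
Proof. by move=> x0; rewrite RRe_real// realE x0. Qed.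

Local Notation cabs z := (complex.Re `|z|).

Lemma cabsE x : (cabs x)%:C = `|x|.
Proof. exact: ge0_Re. Qed.

Lemma cabs_ge0 x : 0 <= cabs x.
Proof. by rewrite -lecR cabsE normr_ge0. Qed.

Lemma cabsM x y : cabs (x * y) = cabs x * cabs y.
Proof.
by apply: complexI; rewrite -[RHS]/((_ * _)%:C) rmorphM [LHS]cabsE normrM; congr (_ * _);
  symmetry; exact: cabsE.
Qed.

Lemma cabs_real t : cabs t%:C = `|t|.
Proof. by rewrite normc_def/= expr0n addr0 sqrtr_sqr. Qed.

Lemma cabsV x : cabs x^-1 = (cabs x)^-1.
Proof.
by apply: complexI; rewrite [LHS]cabsE normfV -[in LHS]cabsE -[RHS]/((_^-1)%:C) fmorphV.
Qed.

Lemma cabsD x y : cabs (x + y) <= cabs x + cabs y.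
Proof. by rewrite -lecR [(_ + _)%:C]rmorphD/= !cabsE ler_normD. Qed.

Lemma cabsN x : cabs (- x) = cabs x.
Proof. by rewrite normrN. Qed.

Lemma cabs_le x : cabs x <= `|complex.Re x| + `|complex.Im x|.
Proof.
rewrite normc_def/= -(@ler_pXn2r _ 2) ?nnegrE ?sqrtr_ge0 ?addr_ge0//.
rewrite sqr_sqrtr ?addr_ge0 ?sqr_ge0// -(normr_id (complex.Re x)).
rewrite -[complex.Re x ^+ 2]real_normK ?num_real// -[complex.Im x ^+ 2]real_normK ?num_real//.
by have := normr_ge0 (complex.Re x); have := normr_ge0 (complex.Im x);
  rewrite normr_id; nra.
Qed.

End ComplexParts.

Notation cabs z := (complex.Re `|z|).

(** * The real-valued norm and the topology it defines *)

Section Hilbert.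
Context {R : realType} {H : completeNormedModType R[i]}.
Implicit Types (u v w : H) (a : R[i]).

Definition rnorm u : R := complex.Re `|u|.

Lemma rnormE u : (rnorm u)%:C = `|u|.
Proof. exact: ge0_Re. Qed.

Lemma rnorm_ge0 u : 0 <= rnorm u.
Proof. by rewrite -lecR rnormE normr_ge0. Qed.

Lemma rnormD u v : rnorm (u + v) <= rnorm u + rnorm v.
Proof. by rewrite -lecR [(_ + _)%:C]rmorphD/= !rnormE ler_normD. Qed.

Lemma rnormN u : rnorm (- u) = rnorm u.
Proof. by rewrite /rnorm normrN. Qed.

Lemma rnormB u v : rnorm (u - v) <= rnorm u + rnorm v.
Proof. by rewrite -(rnormN v) rnormD. Qed.

Lemma rnorm_subC u v : rnorm (u - v) = rnorm (v - u).
Proof. by rewrite -rnormN opprB. Qed.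

Lemma rnorm_subD u v w : rnorm (u - w) <= rnorm (u - v) + rnorm (v - w).
Proof. by apply: le_trans (rnormD _ _); rewrite addrA subrK. Qed.

Lemma rnorm0 : rnorm 0 = 0.
Proof. by rewrite /rnorm normr0. Qed.

Lemma rnorm_eq0 u : rnorm u = 0 -> u = 0.
Proof. by move=> u0; apply/normr0_eq0; rewrite -rnormE u0. Qed.

Lemma rnormZ a u : rnorm (a *: u) = complex.Re `|a| * rnorm u.
Proof.
apply: complexI; rewrite -[RHS]/((_ * _)%:C) rmorphM !rnormE normrZ.
by congr (_ * _); symmetry; exact: ge0_Re.
Qed.

Lemma rnorm_ball u v (e : R) : rnorm (u - v) < e -> ball u e%:C v.
Proof. by move=> uv; rewrite -ball_normE/= -rnormE ltcR. Qed.

Lemma ball_rnorm u v (e : R) : ball u e%:C v -> rnorm (u - v) < e.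
Proof. by rewrite -ball_normE/= -rnormE ltcR. Qed.

Lemma nbhs_rnorm u (P : set H) : nbhs u P <->
  exists2 e : R, 0 < e & forall v, rnorm (u - v) < e -> P v.
Proof.
split=> [/nbhs_ballP[e /= e0 eP]|[e e0 eP]].
  exists (complex.Re e); first by rewrite -ltcR ge0_Re// ltW.
  by move=> v uv; apply: eP; rewrite -[e]ge0_Re ?ltW//; exact: rnorm_ball.
apply/nbhs_ballP; exists e%:C => /=; first by rewrite ltcR.
by move=> v uv; apply: eP; exact: ball_rnorm.
Qed.

Lemma closure_rnorm (S : set (H * H)) p : closure S p <->
  forall e : R, 0 < e -> exists q,
    [/\ S q, rnorm (p.1 - q.1) < e & rnorm (p.2 - q.2) < e].
Proof.
split=> [Sp e e0|Sp].
  have [|q [Sq [/= q1 q2]]] := Sp ([set x | rnorm (p.1 - x) < e] `*`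
    [set x | rnorm (p.2 - x) < e]); last by exists q.
  by exists ([set x | rnorm (p.1 - x) < e], [set x | rnorm (p.2 - x) < e]);
    [split; apply/nbhs_rnorm; exists e|].
move=> B [[B1 B2] /= [/nbhs_rnorm[e1 e10 h1] /nbhs_rnorm[e2 e20 h2]] sB].
have [|q [Sq q1 q2]] := Sp (Num.min e1 e2); first by rewrite lt_min e10.
move: q1 q2; rewrite !lt_min => /andP[q1 _] /andP[_ q2].
by exists q; split=> //; apply: sB; split; [exact: h1|exact: h2].
Qed.

Lemma cvg_rnorm (f : nat -> H) u : f @ \oo --> u <->
  forall e : R, 0 < e -> exists N, forall n, (N <= n)%N -> rnorm (u - f n) < e.
Proof.
split=> [fu e e0|fu].
  have /fu[N _ NP] : nbhs u [set x | rnorm (u - x) < e].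
    by apply/nbhs_rnorm; exists e.
  by exists N => n Nn; exact: NP.
move=> P /nbhs_rnorm[e e0 eP]; have [N NP] := fu e e0.
by exists N => // n /= Nn; apply: eP; exact: NP.
Qed.

Lemma rnorm_cauchy_cvg (f : nat -> H) :
  (forall e : R, 0 < e -> exists N, forall j k, (N <= j)%N -> (N <= k)%N ->
    rnorm (f j - f k) < e) -> exists u, f @ \oo --> u.
Proof.
move=> fC; exists (lim (f @ \oo)).
apply/cvgP/cauchy_cvgP/cauchy_ballP => e e0.
have [|N NP] := fC (complex.Re e); first by rewrite -ltcR ge0_Re// ltW.
pose B := f @` [set n | (N <= n)%N].
have FB : (f @ \oo) B by exists N => // n /= Nn; exists n.
exists (B, B) => //= -[_ _] /= [[j /= Nj <-] [k /= Nk <-]].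
by rewrite -[e]ge0_Re ?ltW//; apply/rnorm_ball/NP.
Qed.

End Hilbert.

(** * Convergent minimizing sequences *)

Lemma inv_succ_small {R : realType} (e : R) : 0 < e ->
  exists N, forall n, (N <= n)%N -> n.+1%:R^-1 < e.
Proof.
move=> e0; exists (Num.truncn e^-1) => n Nn.
rewrite invf_plt ?posrE// (lt_le_trans (truncnS_gt _))//.
by rewrite ler_nat.
Qed.

(** The infima of [Q] over the decreasing sets [K n] increase and stay below [M], so they converge.
    Two late almost minimizers have their midpoint in a common [K N0], where [Q] is nearly as large.
    Constant [K] gives projections; shrinking balls give the form domain. *)
Lemma almost_minimizers {R : realType} (X : lmodType R[i]) (Q : X -> R)
    (K : nat -> set X) (M : R) :
    (forall n, exists2 x, K n x & Q x <= M) ->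
    (forall n x, K n x -> 0 <= Q x) ->
    (forall j k x, (j <= k)%N -> K k x -> K j x) ->
    (forall n x y, K n x -> K n y -> K n (2^-1%:C *: (x + y))) ->
  exists y : nat -> X, [/\ forall n, K n (y n),
    forall n x, K n x -> Q (y n) <= Q x + n.+1%:R^-1 &
    forall e : R, 0 < e -> exists N, forall j k, (N <= j)%N -> (N <= k)%N ->
      Q (y j) + Q (y k) - 2 * Q (2^-1%:C *: (y j + y k)) < e].
Proof.
move=> KM K0 Kle Kmid; pose a n := inf (Q @` K n).
have hasinf n : has_inf (Q @` K n).
  split; first by have [x Kx _] := KM n; exists (Q x), x.
  by exists 0 => _ [x /K0 ? <-].
have aQ n x : K n x -> a n <= Q x.
  by move=> Kx; apply: ge_inf; [exact: (hasinf n).2|exists x].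
have /choice[y yP] n : exists x, K n x /\ Q x < a n + n.+1%:R^-1.
  have n0 : 0 < n.+1%:R^-1 :> R by rewrite invr_gt0.
  by have [_ [x Kx <-] ?] := inf_adherent n0 (hasinf n); exists x.
exists y; split=> [n|n x Kx|e e0]; first exact: (yP n).1.
  by apply: le_trans (ltW (yP n).2) _; rewrite lerD2r aQ.
have hassup : has_sup (range a).
  split; first by exists (a 0), 0.
  by exists M => _ [n _ <-]; have [x Kx] := KM n; have := aQ _ _ Kx; lra.
(* Four errors add up to [e]: two from almost minimality, and twice the gap between [a N0] and the
   supremum. *)
have e40 : 0 < e / 4 by lra.
have [_ [N0 _ <-] aN0] := sup_adherent e40 hassup.
have [N1 N1P] := inv_succ_small e40.
exists (maxn N0 N1) => j k; rewrite !geq_max => /andP[j0 j1] /andP[k0 k1].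
have mid : K N0 (2^-1%:C *: (y j + y k)).
  by apply: Kmid; [apply: Kle j0 _|apply: Kle k0 _]; exact: (yP _).1.
have asup n : a n <= sup (range a).
  by apply: ub_le_sup; [exact: hassup.2|exists n].
have := aQ _ _ mid; have := (yP j).2; have := (yP k).2.
by have := N1P _ j1; have := N1P _ k1; have := asup j; have := asup k;
  move: (j.+1%:R^-1) (k.+1%:R^-1) => *; lra.
Qed.

(** * Inner product, boundary form, projections and closed ranges *)

Section InnerProduct.
Context {R : realType} {H : completeNormedModType R[i]}.
Variable dot : {dot H for Num.conj}.
Implicit Types (u v w : H) (a : R[i]) (t : R) (p q r s : H * H).

Lemma dotDl u v w : dot (u + v) w = dot u w + dot v w.
Proof. exact: linearDl. Qed.
Lemma dotDr u v w : dot w (u + v) = dot w u + dot w v.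
Proof. exact: linearDr. Qed.
Lemma dotNl u w : dot (- u) w = - dot u w.
Proof. exact: linearNl. Qed.
Lemma dotNr u w : dot w (- u) = - dot w u.
Proof. exact: linearNr. Qed.
Lemma dotBl u v w : dot (u - v) w = dot u w - dot v w.
Proof. exact: linearBl. Qed.
Lemma dotBr u v w : dot w (u - v) = dot w u - dot w v.
Proof. exact: linearBr. Qed.
Lemma dotZl a u w : dot (a *: u) w = a * dot u w.
Proof. exact: linearZl_LR. Qed.
Lemma dotZr a u w : dot w (a *: u) = Num.conj a * dot w u.
Proof. exact: linearZr_LR. Qed.
Lemma dot0l w : dot 0 w = 0.
Proof. exact: linear0l. Qed.
Lemma dot0r w : dot w 0 = 0.
Proof. exact: linear0r. Qed.
Lemma dotC u v : dot v u = Num.conj (dot u v).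
Proof. by rewrite hermC expr0 mul1r. Qed.

Definition dotE := (dotBl, dotBr, dotDl, dotDr, dotNl, dotNr, dotZl, dotZr,
  dot0l, dot0r).

Definition rdot u v : R := complex.Re (dot u v).

Lemma rdotC u v : rdot u v = rdot v u.
Proof. by rewrite /rdot (dotC v u) cRe_conj. Qed.
Lemma rdotDl u v w : rdot (u + v) w = rdot u w + rdot v w.
Proof. by rewrite /rdot dotDl cReD. Qed.
Lemma rdotDr u v w : rdot w (u + v) = rdot w u + rdot w v.
Proof. by rewrite /rdot dotDr cReD. Qed.
Lemma rdotNl u w : rdot (- u) w = - rdot u w.
Proof. by rewrite /rdot dotNl cReN. Qed.
Lemma rdotNr u w : rdot w (- u) = - rdot w u.
Proof. by rewrite /rdot dotNr cReN. Qed.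
Lemma rdotZl t u w : rdot (t%:C *: u) w = t * rdot u w.
Proof. by rewrite /rdot dotZl cReM/= mul0r subr0. Qed.
Lemma rdotZr t u w : rdot w (t%:C *: u) = t * rdot w u.
Proof. by rewrite rdotC rdotZl rdotC. Qed.
Lemma rdot0l w : rdot 0 w = 0.
Proof. by rewrite /rdot dot0l. Qed.
Lemma rdot0r w : rdot w 0 = 0.
Proof. by rewrite /rdot dot0r. Qed.

Definition rdotE := (rdotDl, rdotDr, rdotNl, rdotNr, rdotZl, rdotZr,
  rdot0l, rdot0r).

(** Reduces statements about imaginary parts to [rdot] at a rotated vector, so that only real
    estimates have to be proved. *)
Lemma Im_dot u v : complex.Im (dot u v) = rdot u ('i *: v).
Proof.
by rewrite /rdot dotZr cReM /=; ring.
Qed.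

Definition dot2 p q := dot p.1 q.1 + dot p.2 q.2.

(* The symplectic boundary form: on the graph of the adjoint it is
   [(A u, v) - (u, A v)]. *)
Definition bform p q := dot p.2 q.1 - dot p.1 q.2.

Lemma bform_skew p q : bform q p = - Num.conj (bform p q).
Proof.
by rewrite /bform rmorphB/= -!dotC opprB.
Qed.
Lemma bformDl p q r : bform (p + q) r = bform p r + bform q r.
Proof. by rewrite /bform !dotE; ring. Qed.
Lemma bformDr p q r : bform r (p + q) = bform r p + bform r q.
Proof. by rewrite /bform !dotE; ring. Qed.
Lemma bformBl p q r : bform (p - q) r = bform p r - bform q r.
Proof. by rewrite /bform !dotE; ring. Qed.
Lemma bformBr p q r : bform r (p - q) = bform r p - bform r q.
Proof. by rewrite /bform !dotE; ring. Qed.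
Lemma bformZl a p r : bform (a *: p) r = a * bform p r.
Proof. by rewrite /bform !dotE; ring. Qed.
Lemma bformZr a p r : bform r (a *: p) = Num.conj a * bform r p.
Proof. by rewrite /bform !dotE; ring. Qed.

Definition bformE := (bformBl, bformBr, bformDl, bformDr, bformZl, bformZr).

Definition rdot2 p q : R := rdot p.1 q.1 + rdot p.2 q.2.

Lemma dot2_eq0 p q : rdot2 p q = 0 -> rdot2 p ('i *: q) = 0 -> dot2 p q = 0.
Proof.
move=> h1 h2; apply: complex_eqP; rewrite /dot2; first by rewrite cReD.
by rewrite cImD !Im_dot.
Qed.

Definition sqn p : R := rnorm p.1 ^+ 2 + rnorm p.2 ^+ 2.

Lemma sqn_ge0 p : 0 <= sqn p.
Proof. by rewrite addr_ge0// sqr_ge0. Qed.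

Lemma sqn_lt p (e : R) : 0 < e -> sqn p < e ^+ 2 ->
  rnorm p.1 < e /\ rnorm p.2 < e.
Proof.
rewrite /sqn; have := rnorm_ge0 p.1; have := rnorm_ge0 p.2.
by move=> ? ? e0 h; split; rewrite ltNge; apply/negP => ?; nra.
Qed.

Lemma sqn_eq0 p : sqn p = 0 -> p = 0.
Proof.
case: p => u v; rewrite /sqn/= => uv0.
have [u0 v0] : rnorm u = 0 /\ rnorm v = 0.
  by have := rnorm_ge0 u; have := rnorm_ge0 v; split; nra.
by rewrite (rnorm_eq0 u0) (rnorm_eq0 v0).
Qed.

Hypothesis dot_norm : forall u, dot u u = `|u| ^+ 2.

Lemma rnorm_sqr u : rnorm u ^+ 2 = rdot u u.
Proof. by rewrite /rdot dot_norm -rnormE -rmorphXn. Qed.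

Lemma rnorm_sqrC u : dot u u = (rnorm u ^+ 2)%:C.
Proof. by rewrite dot_norm -rnormE -rmorphXn. Qed.

(** Cauchy-Schwarz, from the nonnegative square of the norm of
    [(rnorm v)%:C *: u - (rnorm u)%:C *: v]. *)
Lemma rdot_le u v : rdot u v <= rnorm u * rnorm v.
Proof.
have [u0|/eqP u0] := eqVneq (rnorm u) 0.
  by rewrite u0 (rnorm_eq0 u0) rdot0l mul0r.
have [v0|/eqP v0] := eqVneq (rnorm v) 0.
  by rewrite v0 (rnorm_eq0 v0) rdot0r mulr0.
have uv0 : 0 < rnorm u * rnorm v.
  by rewrite mulr_gt0// lt_neqAle rnorm_ge0 eq_sym; apply/andP; split=> //;
    apply/eqP.
have := sqr_ge0 (rnorm ((rnorm v)%:C *: u - (rnorm u)%:C *: v)).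
rewrite rnorm_sqr !rdotE -!rnorm_sqr (rdotC v u) => h.
by rewrite -subr_ge0 -(pmulr_rge0 _ uv0); nra.
Qed.

Lemma rdot_abs u v : `|rdot u v| <= rnorm u * rnorm v.
Proof.
by rewrite ler_norml rdot_le andbT lerNl -rdotNl -(rnormN u) rdot_le.
Qed.

Lemma sqn_rdot2 p : sqn p = rdot2 p p.
Proof. by rewrite /sqn !rnorm_sqr. Qed.

Lemma dot2_sqn p : dot2 p p = (sqn p)%:C.
Proof. by rewrite /dot2 !rnorm_sqrC -rmorphD. Qed.

Lemma rdot2_abs p q (e : R) : rnorm p.1 <= e -> rnorm p.2 <= e ->
  `|rdot2 p q| <= e * (rnorm q.1 + rnorm q.2).
Proof.
move=> p1 p2; apply: le_trans (ler_normD _ _) _.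
have := rdot_abs p.1 q.1; have := rdot_abs p.2 q.2.
by have := rnorm_ge0 q.1; have := rnorm_ge0 q.2; nra.
Qed.

Lemma dot2_closure (S : set (H * H)) p s :
  (forall q, S q -> dot2 q p = 0) -> closure S s -> dot2 s p = 0.
Proof.
move=> Sp /closure_rnorm Ss.
suff h q : (forall r, S r -> rdot2 r q = 0) -> rdot2 s q = 0.
  apply: dot2_eq0; apply: h => r /Sp; rewrite /dot2.
    by move/(congr1 (@complex.Re _)); rewrite cReD.
  by move/(congr1 (@complex.Im _)); rewrite cImD !Im_dot.
move=> Sq; apply/eqP; rewrite -normr_eq0 eq_le normr_ge0 andbT.
apply/ler_addgt0Pr => e e0; rewrite add0r.
pose b := rnorm q.1 + rnorm q.2 + 1.
have b0 : 0 < b by have := rnorm_ge0 q.1; have := rnorm_ge0 q.2; rewrite /b; lra.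
have [|r [Sr r1 r2]] := Ss (e / b); first by rewrite divr_gt0.
have -> : rdot2 s q = rdot2 (s - r) q.
  by have := Sq _ Sr; rewrite /rdot2 !rdotE/=; lra.
apply: le_trans (rdot2_abs (p := s - r) q (ltW r1) (ltW r2)) _.
rewrite -mulrA; apply: ler_piMr; [exact: ltW|rewrite ler_pdivrMl// mulr1].
by rewrite /b; lra.
Qed.

(** A minimizing sequence for the distance from [p] to [S] is Cauchy by the parallelogram law, and
    varying the minimizer along [q] gives orthogonality. As [S] need not be closed, the limit is
    only claimed in its closure. *)
Lemma projection (S : set (H * H)) p : linear_subspace S ->
  exists s, closure S s /\ forall q, S q -> dot2 q (p - s) = 0.
Proof.
move=> [S0 Slin].
have SZ a q : S q -> S (a *: q) by move=> Sq; rewrite -[_ *: _]addr0; exact: Slin.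
have SD r q : S r -> S q -> S (r + q).
  by move=> Sr Sq; rewrite -[r]scale1r; exact: Slin.
have [||||y [yS ymin yC]] := @almost_minimizers R (H * H)%type
  (fun q => sqn (p - q)) (fun=> S) (sqn p).
- by move=> _; exists 0; rewrite ?subr0.
- by move=> *; exact: sqn_ge0.
- by [].
- by move=> _ r q Sr Sq; apply: SZ; exact: SD.
(* By the parallelogram law the midpoint defect equals half of [sqn (y j - y k)]. *)
have yC2 e : 0 < e -> exists N, forall j k, (N <= j)%N -> (N <= k)%N ->
    rnorm ((y j).1 - (y k).1) < e /\ rnorm ((y j).2 - (y k).2) < e.
  move=> e0; have [|N NP] := yC (e ^+ 2 / 2); first by rewrite divr_gt0 ?exprn_gt0.
  exists N => j k Nj Nk; apply: (@sqn_lt (y j - y k)) => //.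
  have := NP j k Nj Nk; rewrite !sqn_rdot2 /rdot2 /= !rdotE.
  rewrite !(rdotC _ p.1) !(rdotC _ p.2) !(rdotC (y k).1) !(rdotC (y k).2).
  by lra.
have [s1 s1P] : exists u, (fun n => (y n).1) @ \oo --> u.
  apply: rnorm_cauchy_cvg => e /yC2[N NP].
  by exists N => j k Nj Nk; exact: (NP _ _ Nj Nk).1.
have [s2 s2P] : exists u, (fun n => (y n).2) @ \oo --> u.
  apply: rnorm_cauchy_cvg => e /yC2[N NP].
  by exists N => j k Nj Nk; exact: (NP _ _ Nj Nk).2.
have ys e : 0 < e -> exists N, forall n, (N <= n)%N ->
    rnorm (s1 - (y n).1) < e /\ rnorm (s2 - (y n).2) < e.
  move=> e0; move/cvg_rnorm : s1P => /(_ e e0)[N1 N1P].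
  move/cvg_rnorm : s2P => /(_ e e0)[N2 N2P].
  exists (maxn N1 N2) => n; rewrite geq_max => /andP[? ?].
  by split; [exact: N1P|exact: N2P].
exists (s1, s2); split.
  apply/closure_rnorm => e /ys[N NP]; exists (y N).
  by have [? ?] := NP _ (leqnn N); split.
suff h q : S q -> rdot2 q (p - (s1, s2)) = 0.
  move=> q Sq; apply: dot2_eq0; first exact: h.
  (* The imaginary part is the real part for the test vector [- 'i *: q], again in [S]. *)
  rewrite -[RHS](h (- 'i *: q)); last exact: SZ.
  by rewrite /rdot2 /rdot !dotZl !dotZr !cReM !cRe_conj !cIm_conj /=; ring.
move=> Sq; set rho := rdot2 _ _.
(* First-order condition: moving the minimizer by [t *: q] cannot decrease the distance. It is
   obtained from [y n] up to an error [e], half of it from almost minimality and half from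
   [s - y n]. *)
have key t : 2 * t * rho <= t ^+ 2 * sqn q.
  apply/ler_addgt0Pr => e e0.
  pose b := 2 * `|t| * (rnorm q.1 + rnorm q.2) + 1.
  have b0 : 0 < b.
    have := rnorm_ge0 q.1; have := rnorm_ge0 q.2; rewrite /b => ? ?.
    by rewrite ltr_wpDl// !mulr_ge0// addr_ge0.
  have [|N NP] := ys (e / 2 / b); first by rewrite !divr_gt0.
  have [|N' N'P] := @inv_succ_small _ (e / 2); first by rewrite divr_gt0.
  have [h1 h2] := NP _ (leq_maxl N N').
  have h3 := N'P _ (leq_maxr N N').
  move: h1 h2 h3; set n := maxn _ _ => h1 h2 h3.
  have := ymin n (y n + t%:C *: q) (SD _ _ (yS n) (SZ _ _ Sq)).
  have h4 := rdot2_abs (p := (s1, s2) - y n) q (ltW h1) (ltW h2).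
  have h5 : 2 * `|t| * `|rdot2 ((s1, s2) - y n) q| <= e / 2.
    apply: le_trans (_ : 2 * `|t| * (e / 2 / b * (rnorm q.1 + rnorm q.2)) <= _).
      by rewrite ler_wpM2l// mulr_ge0.
    have -> : 2 * `|t| * (e / 2 / b * (rnorm q.1 + rnorm q.2)) =
      e / 2 * (b^-1 * (2 * `|t| * (rnorm q.1 + rnorm q.2))) by ring.
    apply: ler_piMr; [by rewrite divr_ge0 ?ltW|rewrite ler_pdivrMl// mulr1].
    by rewrite /b; lra.
  have {h5} : 2 * t * rdot2 ((s1, s2) - y n) q >= - (e / 2).
    have := ler_norm (- (t * rdot2 ((s1, s2) - y n) q)).
    by rewrite normrN normrM; lra.
  rewrite /rho !sqn_rdot2 /rdot2/= !rdotE.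
  rewrite ?(rdotC q.1 p.1) ?(rdotC q.2 p.2) ?(rdotC (y n).1 p.1).
  rewrite ?(rdotC (y n).2 p.2) ?(rdotC q.1 (y n).1) ?(rdotC q.2 (y n).2).
  rewrite ?(rdotC q.1 s1) ?(rdotC q.2 s2).
  by move: (n.+1%:R^-1) h3 => *; lra.
have s0 : 0 < sqn q + 1 by have := sqn_ge0 q; lra.
(* This [t] turns the inequality into [2 * t ^+ 2 * (sqn q + 1) <= t ^+ 2 * sqn q], which forces
   [t = 0]; the [+ 1] covers [q = 0]. *)
have := key (rho / (sqn q + 1)).
have : 0 <= (rho / (sqn q + 1)) ^+ 2 by exact: sqr_ge0.
have : rho = (rho / (sqn q + 1)) * (sqn q + 1) by rewrite divfK// gt_eqF.
have := sqn_ge0 q.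
set t := rho / _; set z := sqn q => ? tz ? h.
suff : t = 0 by move=> t0; rewrite tz t0 mul0r.
rewrite tz in h; nra.
Qed.

(** Coercivity bounds [p.1] by its image, so preimages of a convergent sequence are Cauchy and the
    range is closed. The last hypothesis makes [w] orthogonal to the complement of the range, hence
    equal to its own projection. *)
Lemma coercive_range (Gam : set (H * H)) (l c : R) w :
    linear_subspace Gam -> closure Gam `<=` Gam -> 0 < c ->
    (forall p, Gam p -> c * rnorm p.1 ^+ 2 <= rdot (p.2 - l%:C *: p.1) p.1) ->
    (forall z, (forall p, Gam p -> dot (p.2 - l%:C *: p.1) z = 0) ->
       dot w z = 0) ->
  exists2 p, Gam p & p.2 - l%:C *: p.1 = w.
Proof.
move=> [Gam0 Glin] Gcl c0 Gc wP.
(* The range is placed in the first factor of [H * H] so that [projection] applies. *)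
pose S : set (H * H) := [set (p.2 - l%:C *: p.1, 0) | p in Gam].
have Slin : linear_subspace S.
  split; first by exists 0 => //=; rewrite scaler0 subr0.
  move=> a _ _ [p Gp <-] [q Gq <-]; exists (a *: p + q); first exact: Glin.
  apply/pair_eqP/andP; split=> /=; apply/eqP; last by rewrite scaler0 addr0.
  rewrite scalerDr !scalerBr !scalerA (mulrC a) opprD.
  by rewrite addrACA.
have [s [Ss sP]] := projection (w, 0) Slin.
have z0 p : Gam p -> dot (p.2 - l%:C *: p.1) (w - s.1) = 0.
  move=> Gp; have := sP (p.2 - l%:C *: p.1, 0); rewrite /dot2/= dot0l addr0.
  by apply; exists p.
have wz := wP _ z0.
have sz : dot2 s (w - s.1, 0) = 0.
  apply: (@dot2_closure S) => // _ [p Gp <-]; rewrite /dot2/= dot0l addr0.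
  exact: z0.
(* The residue [w - s.1] is orthogonal to [s.1] and, by [wP], to [w], hence to itself. *)
have ws : w = s.1.
  apply/eqP; rewrite -subr_eq0 -(dnorm_eq0 dot).
  by move: sz; rewrite /dot2/= dot0r addr0 dotBl wz => ->; rewrite subr0.
have /choice[y yP] n : exists p, Gam p /\
    rnorm (w - (p.2 - l%:C *: p.1)) < n.+1%:R^-1.
  have n0 : 0 < n.+1%:R^-1 :> R by rewrite invr_gt0.
  move/closure_rnorm : Ss => /(_ _ n0) [_ [[p Gp <-] /= h _]].
  by exists p; rewrite ws.
have bnd p : Gam p -> c * rnorm p.1 <= rnorm (p.2 - l%:C *: p.1).
  move=> Gp; have [->|p1] := eqVneq (rnorm p.1) 0.
    by rewrite mulr0 rnorm_ge0.
  have p0 : 0 < rnorm p.1 by rewrite lt_neqAle eq_sym p1 rnorm_ge0.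
  rewrite -(ler_pM2r p0) -mulrA -expr2; apply: le_trans (Gc _ Gp) _.
  exact: rdot_le.
have [u uP] : exists u, (fun n => (y n).1) @ \oo --> u.
  apply: rnorm_cauchy_cvg => e e0.
  have [|N NP] := @inv_succ_small _ (c * e / 2).
    by rewrite divr_gt0// mulr_gt0.
  exists N => j k Nj Nk; rewrite -(ltr_pM2l c0).
  have Gjk : Gam (y j - y k).
    by rewrite addrC -scaleN1r; apply: Glin; exact: (yP _).1.
  apply: le_lt_trans (bnd _ Gjk) _ => /=.
  have := NP j Nj; have := NP k Nk; have := (yP j).2; have := (yP k).2.
  set yj := _ - _ *: (y j).1; set yk := _ - _ *: (y k).1.
  have -> : (y j).2 - (y k).2 - l%:C *: ((y j).1 - (y k).1) = yj - yk.
    by rewrite /yj /yk scalerBr !opprD !opprK addrACA.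
  have := rnorm_subD yj w yk; rewrite (rnorm_subC yj w).
  by move: (j.+1%:R^-1) (k.+1%:R^-1) => *; lra.
move/cvg_rnorm : uP => uP.
exists (u, w + l%:C *: u); last by rewrite /= addrK.
apply/Gcl/closure_rnorm => e e0.
pose b := `|l| + 2.
have b0 : 0 < b by rewrite /b ltr_wpDl.
have [|N NP] := uP (e / b); first by rewrite divr_gt0.
have [|N' N'P] := @inv_succ_small _ (e / b); first by rewrite divr_gt0.
have h1 := NP _ (leq_maxl N N'); have h2 := N'P _ (leq_maxr N N').
move: h1 h2; set n := maxn _ _ => h1 h2.
have eb : e = e / b * (`|l| + 2) by rewrite -/b divfK// gt_eqF.
have eb0 : 0 < e / b by rewrite divr_gt0.
exists (y n); split=> /=; first exact: (yP n).1.
  by apply: lt_le_trans h1 _; rewrite [leRHS]eb; have := normr_ge0 l; nra.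
have -> : w + l%:C *: u - (y n).2 =
    (w - ((y n).2 - l%:C *: (y n).1)) + l%:C *: (u - (y n).1).
  by rewrite scalerBr opprB [RHS]addrACA [l%:C *: (y n).1 - _]addrC addrK.
apply: le_lt_trans (rnormD _ _) _; rewrite rnormZ normc_def/= expr0n addr0 sqrtr_sqr.
have := (yP n).2; have := rnorm_ge0 (u - (y n).1); have := normr_ge0 l.
move: (e / b) eb eb0 h1 h2 => dl -> dl0 h1 h2.
by move: (n.+1%:R^-1) h2 => k h2 l0 r0 h3; nra.
Qed.

Lemma adj_graph_sub (V : set H) (T : H -> H) : linear_subspace (adj_graph dot V T).
Proof.
split=> [u _|a p q Gp Gq u Du]; first by rewrite !dot0r.
by rewrite /= !dotDr !dotZr Gp// Gq.
Qed.

Lemma dot2C p q : dot2 q p = Num.conj (dot2 p q).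
Proof. by rewrite /dot2 rmorphD/= -!dotC. Qed.

Lemma bform_closure (S : set (H * H)) k p :
  (forall q, S q -> bform k q = 0) -> closure S p -> bform k p = 0.
Proof.
have bE q : bform k q = Num.conj (dot2 q (k.2, - k.1)).
  by rewrite -dot2C /dot2 /bform/= dotNl.
move=> kS pS; rewrite bE.
suff -> : dot2 p (k.2, - k.1) = 0 by rewrite rmorph0.
apply: dot2_closure pS => q /kS; rewrite bE => /eqP.
by rewrite conjC_eq0 => /eqP.
Qed.

Lemma adj_graph_bform (V : set H) (T : H -> H) p :
  adj_graph dot V T p <-> forall u, V u -> bform (u, T u) p = 0.
Proof.
split=> h u Vu; first by rewrite /bform (h u Vu) subrr.
by apply/eqP; rewrite -subr_eq0; apply/eqP; exact: h.
Qed.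

Lemma adj_graph_closed (V : set H) (T : H -> H) :
  closure (adj_graph dot V T) `<=` adj_graph dot V T.
Proof.
move=> p pS; apply/adj_graph_bform => u Vu.
by apply: bform_closure pS => q /adj_graph_bform; exact.
Qed.

(** A norm equivalent to the Hilbert norm whose square is [sqn]; its triangle inequality and
    homogeneity follow componentwise. *)
Definition norm1 p : R := rnorm p.1 + rnorm p.2.

Lemma norm1_ge0 p : 0 <= norm1 p.
Proof. by rewrite addr_ge0 ?rnorm_ge0. Qed.

Lemma norm1D p q : norm1 (p + q) <= norm1 p + norm1 q.
Proof. by rewrite /norm1 [leRHS]addrACA lerD ?rnormD. Qed.

Lemma norm1N p : norm1 (- p) = norm1 p.
Proof. by rewrite /norm1/= !rnormN. Qed.

Lemma norm1B p q : norm1 (p - q) <= norm1 p + norm1 q.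
Proof. by rewrite -(norm1N q) norm1D. Qed.

Lemma norm1Z a p : norm1 (a *: p) = cabs a * norm1 p.
Proof. by rewrite /norm1 !rnormZ mulrDr. Qed.

Lemma norm1_eq0 p : norm1 p = 0 -> p = 0.
Proof.
case: p => u v /eqP; rewrite /norm1/= paddr_eq0 ?rnorm_ge0// => /andP[/eqP u0 /eqP v0].
by rewrite (rnorm_eq0 u0) (rnorm_eq0 v0).
Qed.

Lemma sqn_norm1 p (e : R) : norm1 p < e -> sqn p < e ^+ 2.
Proof. by rewrite /norm1 /sqn; have := rnorm_ge0 p.1; have := rnorm_ge0 p.2; nra. Qed.

Lemma norm1_sqn p (e : R) : 0 < e -> sqn p < e ^+ 2 -> norm1 p < 2 * e.
Proof. by move=> e0 /sqn_lt[//|? ?]; rewrite /norm1; lra. Qed.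

Lemma cabs_dot u v : cabs (dot u v) <= 2 * (rnorm u * rnorm v).
Proof.
apply: le_trans (cabs_le _) _; rewrite Im_dot.
have := rdot_abs u v; have := rdot_abs u ('i *: v); rewrite /rdot rnormZ.
have -> : cabs ('i : R[i]) = 1 by rewrite normc_def/= expr0n expr1n add0r sqrtr1.
by lra.
Qed.

Lemma cabs_bform p q : cabs (bform p q) <= 2 * (norm1 p * norm1 q).
Proof.
apply: le_trans (cabsD _ _) _; rewrite cabsN.
have := cabs_dot p.2 q.1; have := cabs_dot p.1 q.2; rewrite /norm1.
have := rnorm_ge0 p.1; have := rnorm_ge0 p.2; have := rnorm_ge0 q.1; have := rnorm_ge0 q.2.
by nra.
Qed.

Lemma cabs_dot2 p q : cabs (dot2 p q) <= 2 * (norm1 p * norm1 q).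
Proof.
apply: le_trans (cabsD _ _) _.
have := cabs_dot p.1 q.1; have := cabs_dot p.2 q.2; rewrite /norm1.
have := rnorm_ge0 p.1; have := rnorm_ge0 p.2; have := rnorm_ge0 q.1; have := rnorm_ge0 q.2.
by nra.
Qed.

End InnerProduct.

Lemma dense_rnorm {R : realType} {H : completeNormedModType R[i]} (S : set H) :
  dense S -> forall x (e : R), 0 < e -> exists2 u, S u & rnorm (x - u) < e.
Proof.
move=> Sd x e e0.
have : nbhs x [set u | rnorm (x - u) < e] by apply/nbhs_rnorm; exists e.
rewrite nbhsE; case=> O [Oo Ox] OP.
have /(Sd O)/(_ Oo)[u [Ou Su]] : O !=set0 by exists x.
by exists u => //; exact: OP.
Qed.

(** * Graphs of the adjoint and of the closure *)

Section GraphSpaces.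
Context {R : realType} {H : completeNormedModType R[i]}.
Variable dot : {dot H for Num.conj}.
Hypothesis dot_norm : forall u : H, dot u u = `|u| ^+ 2.
Variables (Dc : set H) (Ac : H -> H) (m : R).
Hypothesis Dc_sub : linear_subspace Dc.
Hypothesis Dc_dense : dense Dc.
Hypothesis Ac_lin : linear_on Dc Ac.
Hypothesis Ac_sym : symmetric_on dot Dc Ac.
Hypothesis Ac_below : bounded_below dot Dc Ac m.
Implicit Types (u v w x y : H) (a : R[i]) (p q r : H * H).

Local Notation G := (adj_graph dot Dc Ac).
Local Notation G0 := (closure (op_graph Dc Ac)).
Local Notation A := (Amax dot Dc Ac).

Lemma DcD u v : Dc u -> Dc v -> Dc (u + v).
Proof. by move=> Du Dv; rewrite -[u]scale1r; exact: Dc_sub.2. Qed.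

Lemma DcZ a u : Dc u -> Dc (a *: u).
Proof. by move=> Du; rewrite -[_ *: _]addr0; apply: Dc_sub.2 => //; exact: Dc_sub.1. Qed.

Lemma DcB u v : Dc u -> Dc v -> Dc (u - v).
Proof. by move=> Du Dv; rewrite -scaleN1r; apply: DcD => //; exact: DcZ. Qed.

Lemma AcD u v : Dc u -> Dc v -> Ac (u + v) = Ac u + Ac v.
Proof. by move=> Du Dv; rewrite -{1}[u]scale1r Ac_lin// scale1r. Qed.

Lemma Ac0 : Ac 0 = 0.
Proof.
have := AcD Dc_sub.1 Dc_sub.1; rewrite addr0 => h.
by apply: (addrI (Ac 0)); rewrite addr0 -h.
Qed.

Lemma AcZ a u : Dc u -> Ac (a *: u) = a *: Ac u.
Proof.
by move=> Du; rewrite -[_ *: u]addr0 Ac_lin ?Ac0 ?addr0//; exact: Dc_sub.1.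
Qed.

Lemma AcB u v : Dc u -> Dc v -> Ac (u - v) = Ac u - Ac v.
Proof.
by move=> Du Dv; rewrite -scaleN1r AcD ?AcZ ?scaleN1r//; rewrite -scaleN1r; exact: DcZ.
Qed.

Lemma adj_graphD p q : G p -> G q -> G (p + q).
Proof. by move=> Gp Gq; rewrite -[p]scale1r; exact: (adj_graph_sub _ _ _).2. Qed.

Lemma adj_graphZ a p : G p -> G (a *: p).
Proof.
by move=> Gp; rewrite -[_ *: _]addr0; apply: (adj_graph_sub _ _ _).2 => //;
  exact: (adj_graph_sub _ _ _).1.
Qed.

Lemma adj_graphB p q : G p -> G q -> G (p - q).
Proof. by move=> ? ?; rewrite -scaleN1r; apply: adj_graphD => //; exact: adj_graphZ. Qed.

Lemma adj_graph_uniq v w w' : G (v, w) -> G (v, w') -> w = w'.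
Proof.
move=> Gw Gw'; apply/eqP; rewrite -subr_eq0; apply/eqP/rnorm_eq0.
set z := w - w'; have z0 u : Dc u -> rdot dot u z = 0.
  move=> Du; have := Gw u Du; have := Gw' u Du => /= e1 e2.
  by rewrite /rdot /z dotBr -e1 -e2 subrr.
apply/eqP; rewrite eq_le rnorm_ge0 andbT.
apply/ler_addgt0Pr => e e0; rewrite add0r.
have [u Du zu] := dense_rnorm Dc_dense z e0.
have := rdot_le dot_norm (z - u) z; rewrite rdotDl rdotNl (z0 u)// oppr0 addr0.
rewrite -(rnorm_sqr dot_norm) expr2.
have := rnorm_ge0 z; rewrite le_eqVlt => /predU1P[<-|z_gt0]; first by move=> _; exact: ltW.
by rewrite ler_pM2r// => /le_trans; apply; exact: ltW.
Qed.

Lemma DmaxP v : Dmax dot Dc Ac v -> G (v, A v).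
Proof.
move=> [w Gw]; rewrite /Amax; case: xgetP => //= h.
by case: (h w).
Qed.

Lemma Dmax_adj_graph p : G p -> Dmax dot Dc Ac p.1.
Proof. by case: p => u v; exists v. Qed.

Lemma AmaxE p : G p -> p = (p.1, A p.1).
Proof.
move=> Gp; have := DmaxP (Dmax_adj_graph Gp); case: p Gp => u v /= Gp GA.
by rewrite (adj_graph_uniq Gp GA).
Qed.

Lemma op_graph_adj u : Dc u -> G (u, Ac u).
Proof. by move=> Du v Dv /=; exact: Ac_sym. Qed.

Lemma Amax_Dc u : Dc u -> A u = Ac u.
Proof. by move=> /op_graph_adj /AmaxE[]. Qed.

Lemma G0_adj_graph p : G0 p -> G p.
Proof.
move=> G0p; apply: (adj_graph_closed dot_norm); apply: closure_subset G0p.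
by move=> [u v] [/= Du ->]; exact: op_graph_adj.
Qed.

Lemma Dc_G0 u : Dc u -> G0 (u, Ac u).
Proof. by move=> Du; apply: subset_closure. Qed.

Lemma G0_closed : closure G0 `<=` G0.
Proof. exact: closed_closure. Qed.

Lemma closure_sub (S : set (H * H)) :
  linear_subspace S -> linear_subspace (closure S).
Proof.
move=> [S0 Slin]; split; first exact: subset_closure.
move=> a p q /closure_rnorm Sp /closure_rnorm Sq.
apply/closure_rnorm => e e0; pose b := complex.Re `|a| + 1.
have a0 : 0 <= complex.Re `|a| by rewrite -lecR ge0_Re normr_ge0.
have b0 : 0 < b by rewrite /b; lra.
have eb0 : 0 < e / b by rewrite divr_gt0.
have [p' [Sp' p1 p2]] := Sp _ eb0; have [q' [Sq' q1 q2]] := Sq _ eb0.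
exists (a *: p' + q'); split=> /=; first exact: Slin.
all: rewrite opprD addrACA -scalerBr; apply: le_lt_trans (rnormD _ _) _.
all: rewrite rnormZ; have -> : e = e / b * b by rewrite divfK// gt_eqF.
  by move: (e / b) eb0 p1 q1 => *; rewrite /b; nra.
by move: (e / b) eb0 p2 q2 => *; rewrite /b; nra.
Qed.

Lemma op_graph_sub : linear_subspace (op_graph Dc Ac).
Proof.
split=> [|a p q [Dp ep] [Dq eq]]; first by split; [exact: Dc_sub.1|rewrite /= Ac0].
by split=> /=; [exact: Dc_sub.2|rewrite Ac_lin// ep eq].
Qed.

Lemma G0_sub : linear_subspace G0.
Proof. exact: closure_sub op_graph_sub. Qed.

Lemma G0Z a p : G0 p -> G0 (a *: p).
Proof.
by move=> Gp; rewrite -[_ *: _]addr0; apply: G0_sub.2 => //; exact: G0_sub.1.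
Qed.

Lemma DminP v : Dmin Dc Ac v <-> G0 (v, A v).
Proof.
split=> [[w G0w]|]; last by exists (A v).
by have := AmaxE (G0_adj_graph G0w); rewrite /= => <-.
Qed.

Lemma Dmin_G0 p : G0 p -> Dmin Dc Ac p.1.
Proof. by case: p => u v; exists v. Qed.

(** The defining identity of the adjoint on [Dc], extended to the closure by continuity. Hence
    [bform] descends to [G] modulo [G0]. *)
Lemma bform_G0 p q : G0 p -> G q -> bform dot p q = 0.
Proof.
move=> G0p Gq; have -> : bform dot p q = dot2 dot p (- q.2, q.1).
  by rewrite /bform /dot2/= dotNr addrC.
apply: (dot2_closure dot_norm) G0p => -[u v] [/= Du ->].
by rewrite /dot2/= dotNr (Gq u Du) addNr.
Qed.

Lemma bform_G0r p q : G0 p -> G q -> bform dot q p = 0.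
Proof. by move=> G0p Gq; rewrite bform_skew bform_G0// rmorph0 oppr0. Qed.

Lemma G0_approx p (e : R) : 0 < e -> G0 p -> exists2 x, Dc x &
  [/\ rnorm (p.1 - x) < e, `|rdot dot p.2 p.1 - rdot dot (Ac x) x| < e &
      `|rnorm p.1 ^+ 2 - rnorm x ^+ 2| < e].
Proof.
(* With error [d = e / b <= e] the two differences are at most [d * (rnorm p.1 + rnorm p.2 + d)] and
   [d * (2 * rnorm p.1 + d)]; [b] exceeds both factors. *)
move=> e0 /closure_rnorm G0p; pose b := rnorm p.1 + rnorm p.2 + rnorm p.1 + e + 2.
have := rnorm_ge0 p.1; have := rnorm_ge0 p.2 => p20 p10.
have b0 : 0 < b by rewrite /b; lra.
have eb0 : 0 < e / b by rewrite divr_gt0.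
have [[x y] [[/= Dx ->] x1 x2]] := G0p _ eb0.
have eb : e = e / b * b by rewrite divfK// gt_eqF.
have ebe : e / b <= e by rewrite ler_pdivrMr// ler_peMr ?ltW// /b; lra.
have rx : rnorm x <= rnorm p.1 + e / b.
  have := rnormB p.1 (p.1 - x); rewrite subKr; lra.
exists x => //; split; first exact: lt_le_trans ebe.
  have -> : rdot dot p.2 p.1 - rdot dot (Ac x) x =
      rdot dot (p.2 - Ac x) x + rdot dot p.2 (p.1 - x).
    by rewrite !rdotE; ring.
  apply: le_lt_trans (ler_normD _ _) _.
  have := rdot_abs dot_norm (p.2 - Ac x) x; have := rdot_abs dot_norm p.2 (p.1 - x).
  have := rnorm_ge0 x; have := rnorm_ge0 (p.2 - Ac x); have := rnorm_ge0 (p.1 - x).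
  move: (e / b) eb eb0 ebe rx x1 x2 => d eb d0 ebe rx x1 x2 *.
  by rewrite [ltRHS]eb /b; nra.
have -> : rnorm p.1 ^+ 2 - rnorm x ^+ 2 =
    rdot dot (p.1 - x) p.1 + rdot dot (p.1 - x) x.
  by rewrite !(rnorm_sqr dot_norm) !rdotE (rdotC dot x p.1); ring.
apply: le_lt_trans (ler_normD _ _) _.
have := rdot_abs dot_norm (p.1 - x) x; have := rdot_abs dot_norm (p.1 - x) p.1.
have := rnorm_ge0 x; have := rnorm_ge0 (p.1 - x).
move: (e / b) eb eb0 ebe rx x1 x2 => d eb d0 ebe rx x1 x2 *.
by rewrite [ltRHS]eb /b; nra.
Qed.

(** The order of [R[i]] relates only numbers with equal imaginary parts, so the lower bound already
    makes the form real. *)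
Lemma Ac_rdot u : Dc u -> dot (Ac u) u = (rdot dot (Ac u) u)%:C.
Proof.
move=> Du; apply: complex_eqP => //=; have := Ac_below Du.
by rewrite -rnormE -rmorphXn -rmorphM lecE => /andP[/eqP-> _].
Qed.

Lemma Ac_rdot_ge u : Dc u -> m * rnorm u ^+ 2 <= rdot dot (Ac u) u.
Proof.
by move=> Du; have := Ac_below Du; rewrite -rnormE -rmorphXn -rmorphM Ac_rdot// lecR.
Qed.

Lemma G0_rdot_ge p : G0 p -> m * rnorm p.1 ^+ 2 <= rdot dot p.2 p.1.
Proof.
move=> G0p; apply/ler_addgt0Pr => e e0; pose b := `|m| + 1.
have b0 : 0 < b by rewrite /b ltr_wpDl.
have [|x Dx [_ h1 h2]] := G0_approx (e := e / b) _ G0p; first by rewrite divr_gt0.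
have := Ac_rdot_ge Dx.
have eb0 : 0 < e / b by rewrite divr_gt0.
have : e = e / b * b by rewrite divfK// gt_eqF.
move: h1 h2; rewrite !ltr_norml => /andP[h1 h2] /andP[h3 h4].
move: (e / b) h1 h2 h3 h4 eb0 => d h1 h2 h3 h4 d0 -> h5.
have := ler_norm m; have := ler_norm (- m); rewrite normrN /b => *; nra.
Qed.


(** * The Friedrichs form domain and its isotropy *)

Definition form_re u : R := rdot dot (Ac u) u + (1 - m) * rnorm u ^+ 2.

Lemma form_sqnormE u : Dc u -> form_sqnorm dot Ac m u = (form_re u)%:C.
Proof.
move=> Du; rewrite /form_sqnorm Ac_rdot// -rnormE -rmorphXn.
by apply: complex_eqP; rewrite !(cReD, cReM, cImD, cImM, cReN, cImN)/= /form_re; ring.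
Qed.

Lemma form_re_ge u : Dc u -> rnorm u ^+ 2 <= form_re u.
Proof. by move=> /Ac_rdot_ge; rewrite /form_re; lra. Qed.

Lemma form_re_ge0 u : Dc u -> 0 <= form_re u.
Proof. by move=> /form_re_ge; apply: le_trans; exact: sqr_ge0. Qed.

Lemma form_re_parallelogram u v : Dc u -> Dc v ->
  form_re (u + v) + form_re (u - v) = 2 * form_re u + 2 * form_re v.
Proof.
move=> Du Dv; rewrite /form_re !(rnorm_sqr dot_norm) AcD// AcB//.
by rewrite !rdotE; ring.
Qed.

Lemma form_reZ a u : Dc u -> form_re (a *: u) = (complex.Re `|a|) ^+ 2 * form_re u.
Proof.
move=> Du; rewrite /form_re AcZ// rnormZ /rdot dotZl dotZr mulrA.
rewrite -normCK -(@ge0_Re _ `|a|)// -rmorphXn.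
by rewrite cReM /=; ring.
Qed.

(** Cauchy-Schwarz for the shifted form, with a weight [s] instead of a product of norms: expand
    [form_re] at [u - (t * 'i) *: v], which is nonnegative, for [t = s] and [t = - s]. *)
Lemma form_re_Im u v (s : R) : Dc u -> Dc v -> 0 < s ->
  2 * s * `|complex.Im (dot (Ac u) v + (1 - m)%:C * dot u v)| <=
  form_re u + s ^+ 2 * form_re v.
Proof.
move=> Du Dv s0.
have key (t : R) : t ^+ 2 = s ^+ 2 ->
    2 * t * complex.Im (dot (Ac u) v + (1 - m)%:C * dot u v) <=
    form_re u + s ^+ 2 * form_re v.
  move=> ts; have Dtv : Dc ((t%:C * 'i) *: v) by exact: DcZ.
  have := form_re_ge0 (DcB Du Dtv).
  rewrite /form_re !(rnorm_sqr dot_norm) AcB// AcZ// -ts.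
  rewrite -!scalerA !rdotE.
  have e1 : rdot dot (Ac u) ('i *: v) = complex.Im (dot (Ac u) v).
    by rewrite Im_dot.
  have e2 : rdot dot u ('i *: v) = complex.Im (dot u v) by rewrite Im_dot.
  have e3 : rdot dot ('i *: Ac v) u = complex.Im (dot (Ac u) v).
    rewrite /rdot dotZl (Ac_sym Dv Du) (dotC dot (Ac u) v) cReM cRe_conj cIm_conj/=.
    by ring.
  have e4 : rdot dot ('i *: v) u = complex.Im (dot u v) by rewrite rdotC e2.
  have e5 : rdot dot ('i *: Ac v) ('i *: v) = rdot dot (Ac v) v.
    by rewrite /rdot dotZl dotZr !cReM !cImM cRe_conj cIm_conj/=; ring.
  have e6 : rdot dot ('i *: v) ('i *: v) = rdot dot v v.
    by rewrite /rdot dotZl dotZr !cReM !cImM cRe_conj cIm_conj/=; ring.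
  rewrite e1 e2 e3 e4 e5 e6 cImD cImM/=; lra.
have := key s erefl; have := key (- s) (sqrrN s).
by set I := complex.Im _; case: (ger0P I) => I0; lra.
Qed.

(* The lower semicontinuous envelope of the form is finite at [x]. *)
Definition form_bounded_limit x := exists M : R, forall e : R, 0 < e ->
  exists y, [/\ Dc y, rnorm (x - y) < e & form_re y <= M].

(** A form-Cauchy sequence is form-bounded. Conversely, bounded approximants are replaced by almost
    minimizers of [form_re] over shrinking balls around [x]; these are form-Cauchy by the
    parallelogram law. *)
Lemma friedrichs_form_domP x :
  friedrichs_form_dom dot Dc Ac m x <-> form_bounded_limit x.
Proof.
split=> [[u_ [Du uC /cvg_rnorm ux]]|[M xM]].
  have [N NP] := uC 1 ltr01.
  exists (2 + 2 * form_re (u_ N)) => e e0; have [N' N'P] := ux e e0.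
  exists (u_ (maxn N N')); split=> //; first by apply: N'P; rewrite leq_maxr.
  set n := maxn N N'.
  have Dd := DcB (Du n) (Du N).
  have := NP n N (leq_maxl _ _) (leqnn _).
  rewrite form_sqnormE// -[1]/(1%:C) ltcR.
  have := form_re_parallelogram (Dd) (Du N); rewrite subrK.
  by have := form_re_ge0 (DcB Dd (Du N)); lra.
pose K n : set H := [set y | Dc y /\ rnorm (x - y) < n.+1%:R^-1].
have [||||y [yK _ yC]] := @almost_minimizers R H form_re K M.
- move=> n; have [|y [Dy xy yM]] := xM n.+1%:R^-1; first by rewrite invr_gt0.
  by exists y.
- by move=> n y [Dy _]; exact: form_re_ge0.
- move=> j k y jk [Dy xy]; split=> //; apply: lt_le_trans xy _.
  by rewrite lef_pV2 ?posrE// ler_nat.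
- move=> n u v [Du xu] [Dv xv]; split; first by apply: DcZ; exact: DcD.
  have -> : x - 2^-1%:C *: (u + v) = 2^-1%:C *: ((x - u) + (x - v)).
    rewrite addrACA -opprD [RHS]scalerBr; congr (_ - _).
    rewrite -[x in RHS]scale1r -scalerDl scalerA -[LHS]scale1r; congr (_ *: _).
    by apply: complex_eqP; rewrite !(cReM, cImM, cReD, cImD)/=; lra.
  have h2 : complex.Re `|2^-1%:C| = 2^-1 :> R.
    by rewrite normc_def/= expr0n addr0 sqrtr_sqr ger0_norm// invr_ge0.
  rewrite rnormZ h2; have := rnormD (x - u) (x - v).
  by move: (n.+1%:R^-1) xu xv => *; lra.
exists y; split=> [n|e e0|]; first exact: (yK n).1.
- have e'0 : 0 < complex.Re e by rewrite -ltcR ge0_Re// ltW.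
  have [|N NP] := yC (complex.Re e / 2); first by rewrite divr_gt0.
  exists N => j k Nj Nk; have := NP j k Nj Nk.
  have Dj := (yK j).1; have Dk := (yK k).1.
  rewrite form_sqnormE; last exact: DcB.
  rewrite -[e in _ -> _ < e]ge0_Re ?ltW// ltcR form_reZ; last exact: DcD.
  have -> : complex.Re `|2^-1%:C| = 2^-1 :> R.
    by rewrite normc_def/= expr0n addr0 sqrtr_sqr ger0_norm// invr_ge0.
  have := form_re_parallelogram Dj Dk; lra.
- apply/cvg_rnorm => e /inv_succ_small[N NP]; exists N => n Nn.
  exact: lt_trans (yK n).2 (NP _ Nn).
Qed.

Lemma form_bounded_limitD u v : form_bounded_limit u -> form_bounded_limit v ->
  form_bounded_limit (u + v).
Proof.
move=> [M uM] [N vN]; exists (2 * M + 2 * N) => e e0.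
have e20 : 0 < e / 2 by lra.
have [x [Dx ux xM]] := uM _ e20; have [y [Dy vy yN]] := vN _ e20.
exists (x + y); split; first exact: DcD.
  by rewrite opprD addrACA; have := rnormD (u - x) (v - y); lra.
have := form_re_parallelogram Dx Dy; have := form_re_ge0 (DcB Dx Dy); lra.
Qed.

Lemma form_bounded_limitZ a u : form_bounded_limit u ->
  form_bounded_limit (a *: u).
Proof.
move=> [M uM]; set b := complex.Re `|a|.
have b0 : 0 <= b by rewrite /b -lecR ge0_Re normr_ge0.
exists (b ^+ 2 * M) => e e0.
have eb0 : 0 < e / (b + 1) by rewrite divr_gt0// ltr_wpDl.
have eb : e = e / (b + 1) * (b + 1) by rewrite divfK// gt_eqF// ltr_wpDl.
have [x [Dx ux xM]] := uM _ eb0.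
exists (a *: x); split; first exact: DcZ.
  rewrite -scalerBr rnormZ -/b; have := rnorm_ge0 (u - x).
  by move: (e / (b + 1)) eb eb0 ux => d -> *; nra.
by rewrite form_reZ// -/b ler_wpM2l// sqr_ge0.
Qed.

Lemma form_bounded_limit_G0 p : G0 p -> form_bounded_limit p.1.
Proof.
move=> G0p; exists (`|rdot dot p.2 p.1| + 1 + (1 + `|m|) * (rnorm p.1 ^+ 2 + 1)).
move=> e e0; have [|x Dx [px h1 h2]] := G0_approx (e := Num.min e 1) _ G0p.
  by rewrite lt_min e0 ltr01.
exists x; split=> //; first by move: px; rewrite lt_min => /andP[].
move: h1 h2; rewrite !lt_min => /andP[_ +] /andP[_ +]; rewrite /form_re.
rewrite !ltr_norml => /andP[? ?] /andP[? ?].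
have := ler_norm (rdot dot p.2 p.1); have := ler_norm (- m); rewrite normrN.
by have := sqr_ge0 (rnorm x); have := ler_norm m; nra.
Qed.

Lemma low_energy_form_dom x (N : R) :
    (forall e T : R, 0 < e -> exists p q, [/\ G p, G0 q, sqn p <= N,
       rnorm (x - p.1) < e &
       rdot dot (p.2 + q.2) (p.1 + q.1) <= - T * rnorm (p.1 + q.1) ^+ 2]) ->
  form_bounded_limit x.
Proof.
move=> xN; exists (4 * N + 2 + (1 + `|m|) * (2 * N + 2) + 2 + `|m|) => e e0.
pose d := Num.min (e / 3) 1.
have d0 : 0 < d by rewrite lt_min ltr01 divr_gt0.
have d1 : d <= 1 by rewrite ge_min lexx orbT.
have de : d <= e / 3 by rewrite ge_min lexx.
(* The energy bound will give [kap * U ^+ 2 <= (4 + 2 * |m|) * N] for [U] the norm of [p.1 + q.1];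
   this [kap] then forces [U < d]. *)
pose kap := ((4 + 2 * `|m|) * `|N| + 1) / d ^+ 2.
have kap0 : 0 < kap.
  by rewrite divr_gt0 ?exprn_gt0// ltr_wpDl// mulr_ge0// addr_ge0// mulr_ge0.
have [p [q [Gp G0q pN xp en]]] := xN d (2 + 2 * `|m| + kap) d0.
have kd : kap * d ^+ 2 = (4 + 2 * `|m|) * `|N| + 1.
  by rewrite divfK// gt_eqF// exprn_gt0.
have N0 : 0 <= N by apply: le_trans pN; exact: sqn_ge0.
rewrite (ger0_norm N0) in kd.
have [y Dy [qy h1 h2]] := G0_approx d0 G0q.
(* The two cross terms of the energy agree because [bform] vanishes between [G0] and [G]. *)
have bpq : rdot dot q.2 p.1 = rdot dot p.2 q.1.
  have := bform_G0 G0q Gp; rewrite /bform => /eqP; rewrite subr_eq0 => /eqP.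
  by move=> /(congr1 (@complex.Re _)); rewrite (rdotC dot p.2).
have ge := G0_rdot_ge G0q.
move: en; rewrite !rdotE bpq => en.
have := rdot_abs dot_norm p.2 p.1; have := rdot_abs dot_norm p.2 q.1.
rewrite !ler_norml => /andP[k1 k2] /andP[k3 k4].
have m1 := ler_norm m; have m2 := ler_norm (- m); rewrite normrN in m2.
move: pN; rewrite /sqn => pN.
have q2 : rnorm q.1 ^+ 2 <= 2 * rnorm (p.1 + q.1) ^+ 2 + 2 * N.
  have := rnormB (p.1 + q.1) p.1; rewrite [p.1 + q.1]addrC addrK.
  have := rnorm_ge0 q.1; have := rnorm_ge0 (q.1 + p.1); have := rnorm_ge0 p.1.
  have := sqr_ge0 (rnorm p.2); have := sqr_ge0 (rnorm (q.1 + p.1) - rnorm p.1).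
  nra.
set U := rnorm (p.1 + q.1) in en q2 *.
have U0 : 0 <= U by exact: rnorm_ge0.
have k5 : rnorm p.2 * rnorm p.1 <= N.
  have := sqr_ge0 (rnorm p.2 - rnorm p.1); have := sqr_ge0 (rnorm p.2);
  have := sqr_ge0 (rnorm p.1); nra.
have k6 : 2 * (rnorm p.2 * rnorm q.1) <= N + rnorm q.1 ^+ 2.
  by have := sqr_ge0 (rnorm p.2 - rnorm q.1); have := sqr_ge0 (rnorm p.1); nra.
(* The summand [2] in the choice of [T] absorbs the [2 * U ^+ 2] that bounds part of
   [rnorm q.1 ^+ 2]; the summand [2 * |m|] is kept for the lower bound [m] in [k8]. *)
have k7 : rdot dot q.2 q.1 <= - (2 * `|m| + kap) * U ^+ 2 + 4 * N by nra.
have m0 : 0 <= `|m| by [].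
have k8 : kap * U ^+ 2 <= (4 + 2 * `|m|) * N.
  have : - `|m| * rnorm q.1 ^+ 2 <= m * rnorm q.1 ^+ 2.
    by rewrite ler_wpM2r ?sqr_ge0//; lra.
  have : `|m| * rnorm q.1 ^+ 2 <= `|m| * (2 * U ^+ 2 + 2 * N) by rewrite ler_wpM2l.
  by lra.
have k9 : U < d.
  rewrite ltNge; apply/negP => dU.
  have : d ^+ 2 <= U ^+ 2 by rewrite ler_sqr ?nnegrE// ltW.
  rewrite -(ler_pM2l kap0); lra.
have U1 : U ^+ 2 <= 1 by rewrite expr_le1// (le_trans (ltW k9)).
(* Since [p.1 + q.1] is small, [x] is close to [p.1], hence to [- q.1], hence to [- y]. *)
exists (- y); split.
- by rewrite -scaleN1r; exact: DcZ.
- have -> : x - - y = (x - p.1) + ((p.1 + q.1) - (q.1 - y)).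
    by rewrite opprK opprB [p.1 + q.1 + _]addrACA subrr addr0 addrA subrK.
  have := rnormD (x - p.1) ((p.1 + q.1) - (q.1 - y)).
  have := rnormB (p.1 + q.1) (q.1 - y); rewrite -/U; lra.
rewrite -scaleN1r form_reZ// normrN1 /= expr1n mul1r /form_re.
move: h1 h2; rewrite !ltr_norml => /andP[h1 h1'] /andP[h2 h2'].
have k10 : rdot dot q.2 q.1 <= 4 * N.
  have : 0 <= (2 * `|m| + kap) * U ^+ 2.
    by apply: mulr_ge0 (sqr_ge0 _); apply: addr_ge0 (ltW kap0); exact: mulr_ge0.
  by lra.
have : (1 - m) * rnorm y ^+ 2 <= (1 + `|m|) * (2 * N + 3).
  have : (1 - m) * rnorm y ^+ 2 <= (1 + `|m|) * rnorm y ^+ 2.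
    by rewrite ler_wpM2r ?sqr_ge0//; lra.
  move/le_trans; apply; rewrite ler_wpM2l//; lra.
by lra.
Qed.

(** Along a form-Cauchy sequence tending to [p.1] the form at [(u_ j, u_ k)] is nearly real. Letting
    first [k], then [j] tend to infinity, with the adjoint relation in between, shows that
    [(p.1, p.2)] is real. *)
Lemma form_dom_symmetric p : G p -> form_bounded_limit p.1 -> bform dot p p = 0.
Proof.
move=> Gp /friedrichs_form_domP[u_ [Du uC /cvg_rnorm ux]].
have lim z (e : R) N : (forall n, (N <= n)%N -> `|rdot dot z (u_ n)| <= e) ->
    `|rdot dot z p.1| <= e.
  move=> zN; apply/ler_addgt0Pr => d d0.
  have z1 : 0 < rnorm z + 1 by have := rnorm_ge0 z; lra.
  have [|N' N'P] := ux (d / (rnorm z + 1)); first by rewrite divr_gt0.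
  have h1 := zN _ (leq_maxl N N'); have h2 := N'P _ (leq_maxr N N').
  move: h1 h2; set n := maxn _ _ => h1 h2.
  have -> : rdot dot z p.1 = rdot dot z (u_ n) + rdot dot z (p.1 - u_ n).
    by rewrite !rdotE; ring.
  apply: le_trans (ler_normD _ _) _; rewrite lerD//.
  apply: le_trans (rdot_abs dot_norm _ _) _.
  apply: le_trans (_ : rnorm z * (d / (rnorm z + 1)) <= _).
    by rewrite ler_wpM2l ?rnorm_ge0// ltW.
  by rewrite mulrA ler_pdivrMr// mulrC ler_wpM2l ?ltW// ltrDl.
have bnd : exists N M, 0 < M /\ forall n, (N <= n)%N -> form_re (u_ n) <= M.
  have [N NP] := uC 1 ltr01.
  exists N, (2 + 2 * form_re (u_ N) + 1); split.
    by have := form_re_ge0 (Du N); lra.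
  move=> n Nn; have Dd := DcB (Du n) (Du N).
  have := NP n N Nn (leqnn _).
  rewrite form_sqnormE// -[1]/(1%:C) ltcR.
  have := form_re_parallelogram (Dd) (Du N); rewrite subrK.
  by have := form_re_ge0 (DcB Dd (Du N)); lra.
have [N [M [M0 NM]]] := bnd.
have Im0 : complex.Im (dot p.1 p.2) = 0.
  apply/eqP; rewrite -normr_eq0 eq_le normr_ge0 andbT.
  apply/ler_addgt0Pr => e e0; rewrite add0r.
  (* This weight balances the bounds [s * e] on the form of the difference and [s ^+ 2 * M] on the
     form of [u_ k]. *)
  pose s := e / M; have s0 : 0 < s by rewrite divr_gt0.
  have sM : s * M = e by rewrite divfK// gt_eqF.
  have [|N' N'P] := uC (s * e)%:C; first by rewrite ltcR mulr_gt0.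
  pose L := maxn N N'.
  have small j k : (L <= j)%N -> (L <= k)%N ->
      `|complex.Im (dot (Ac (u_ j)) (u_ k) + (1 - m)%:C * dot (u_ j) (u_ k))| <= e.
    rewrite !geq_max => /andP[Nj N'j] /andP[Nk N'k].
    have := form_re_Im (DcB (Du j) (Du k)) (Du k) s0.
    have := N'P j k N'j N'k; rewrite form_sqnormE ?ltcR; last exact: DcB.
    have := NM k Nk.
    (* The form is real on the diagonal, so subtracting [u_ k] in the first argument leaves the
       imaginary part unchanged. *)
    have -> : complex.Im (dot (Ac (u_ j - u_ k)) (u_ k) +
        (1 - m)%:C * dot (u_ j - u_ k) (u_ k)) =
        complex.Im (dot (Ac (u_ j)) (u_ k) + (1 - m)%:C * dot (u_ j) (u_ k)).
      rewrite AcB// !dotBl (Ac_rdot (Du k)) (rnorm_sqrC dot_norm).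
      by rewrite !(cImD, cImM, cImN, cReD, cReN)/=; ring.
    set I := `|_| => h1 h2 h3.
    have h4 : s ^+ 2 * form_re (u_ k) <= s * e.
      have : 0 <= s ^+ 2 * (M - form_re (u_ k)).
        by rewrite mulr_ge0 ?sqr_ge0// subr_ge0.
      by rewrite -sM; lra.
    by rewrite -(ler_pM2l s0); lra.
  (* Represents the imaginary part of the form at [u_ j] as an inner product, so that [lim] passes
     to the limit in [k]. *)
  pose z j := - 'i *: (Ac (u_ j) + (1 - m)%:C *: u_ j).
  have zE j v : rdot dot (z j) v =
      complex.Im (dot (Ac (u_ j)) v + (1 - m)%:C * dot (u_ j) v).
    rewrite /rdot /z dotZl dotDl dotZl.
    by rewrite !(cReD, cReM, cImD, cImM, cReN, cImN)/=; ring.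
  have small1 j : (L <= j)%N -> `|rdot dot (z j) p.1| <= e.
    move=> Lj; apply: (lim _ _ L) => k Lk; rewrite zE; exact: small.
  have small2 j : (L <= j)%N ->
      `|rdot dot ('i *: p.2 + (1 - m)%:C *: ('i *: p.1)) (u_ j)| <= e.
    move=> /small1; rewrite zE (Gp _ (Du j)) rdotDl rdotZl.
    rewrite !(rdotC dot ('i *: _)) -!Im_dot cImD cImM/=.
    by rewrite mul0r addr0.
  have := lim _ _ _ small2; rewrite rdotDl rdotZl.
  rewrite !(rdotC dot ('i *: _)) -!Im_dot (rnorm_sqrC dot_norm p.1)/=.
  by rewrite mulr0 addr0.
rewrite /bform (dotC dot p.1 p.2); apply: complex_eqP.
  by rewrite cReD cReN cRe_conj subrr.
by rewrite cImD cImN cIm_conj Im0/= oppr0 addr0.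
Qed.

(** Polarization of [form_dom_symmetric] with the factors [1] and ['i]. *)
Lemma form_dom_isotropic p q : G p -> G q ->
  form_bounded_limit p.1 -> form_bounded_limit q.1 -> bform dot p q = 0.
Proof.
move=> Gp Gq Fp Fq.
have h a : a * bform dot q p + Num.conj a * bform dot p q = 0.
  have : bform dot (p + a *: q) (p + a *: q) = 0.
    apply: form_dom_symmetric.
      by apply: adj_graphD => //; exact: adj_graphZ.
    by apply: form_bounded_limitD => //; exact: form_bounded_limitZ.
  rewrite !bformE (form_dom_symmetric Gp Fp) (form_dom_symmetric Gq Fq).
  by rewrite !mulr0 add0r addr0 addrC.
have h1 := h 1; have h2 := h 'i.
rewrite rmorph1 !mul1r in h1.
have ci : Num.conj ('i : R[i]) = - 'i.
  by apply: complex_eqP; rewrite /= ?oppr0.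
move: h2; rewrite ci mulNr -mulrBr => /eqP; rewrite mulf_eq0 => /orP[|].
  by rewrite eq_complex/= oner_eq0 andbF.
rewrite subr_eq0 => /eqP e; rewrite e in h1.
by move/eqP : h1; rewrite -mulr2n mulrn_eq0/= => /eqP.
Qed.

(** * The defect space and compactness of its bounded subsets *)

Lemma sqnZ a p : sqn (a *: p) = complex.Re `|a| ^+ 2 * sqn p.
Proof. by rewrite /sqn !rnormZ mulrDr !exprMn. Qed.

Definition defect_graph p := G p /\ forall q, G0 q -> dot2 dot q p = 0.
Local Notation E := defect_graph.

Lemma defect_spaceP u : defect_space dot Dc Ac u <-> E (u, A u).
Proof.
split=> [[Du uP]|[Gu uP]].
  split=> [|q G0q]; first exact: DmaxP.
  rewrite (AmaxE (G0_adj_graph G0q)) dot2C.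
  have /= := uP _ (Dmin_G0 G0q); rewrite /dotA /dot2/= addrC => ->.
  by rewrite rmorph0.
split; first exact: (Dmax_adj_graph Gu).
move=> v /DminP/uP; rewrite dot2C /dotA /dot2/= addrC => /eqP.
by rewrite conjC_eq0 => /eqP.
Qed.

Lemma defect_graphE p : E p -> defect_space dot Dc Ac p.1.
Proof. by move=> Ep; apply/defect_spaceP; rewrite -(AmaxE Ep.1). Qed.

Lemma defect_graph_lin a p q : E p -> E q -> E (a *: p + q).
Proof.
move=> [Gp Ep] [Gq Eq]; split; first exact: (adj_graph_sub _ _ _).2.
move=> r G0r; have := Ep r G0r; have := Eq r G0r.
rewrite /dot2/= !dotE => e1 e2.
have -> : Num.conj a * dot r.1 p.1 + dot r.1 q.1 +
    (Num.conj a * dot r.2 p.2 + dot r.2 q.2) =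
  Num.conj a * (dot r.1 p.1 + dot r.2 p.2) + (dot r.1 q.1 + dot r.2 q.2) by ring.
by rewrite e1 e2 mulr0 addr0.
Qed.

Lemma defect_graph0 : E 0.
Proof.
by split; [exact: (adj_graph_sub _ _ _).1|move=> q _; rewrite /dot2 !dot0r addr0].
Qed.

Lemma defect_graphD p q : E p -> E q -> E (p + q).
Proof. by move=> Ep Eq; rewrite -[p]scale1r; exact: defect_graph_lin. Qed.

Lemma defect_graphZ a p : E p -> E (a *: p).
Proof.
move=> Ep; rewrite -[_ *: _]addr0; apply: defect_graph_lin => //.
exact: defect_graph0.
Qed.

Lemma defect_graphB p q : E p -> E q -> E (p - q).
Proof.
by move=> Ep Eq; rewrite -scaleN1r; apply: defect_graphD => //; exact: defect_graphZ.
Qed.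

Lemma defect_graph_closed : closure E `<=` E.
Proof.
move=> p Ep; split.
  by apply: (adj_graph_closed dot_norm); apply: closure_subset Ep => q [].
move=> q G0q; rewrite dot2C; suff -> : dot2 dot p q = 0 by rewrite rmorph0.
by apply: (dot2_closure dot_norm) Ep => r [_ /(_ q G0q)]; rewrite dot2C => /eqP;
  rewrite conjC_eq0 => /eqP.
Qed.

(* On the defect space the adjoint is a complex structure: [A (A u) = - u]. *)
Lemma defect_graph_rot p : E p -> E (p.2, - p.1).
Proof.
move=> [Gp Ep]; split=> [u Du|q G0q] /=.
  have := Ep _ (Dc_G0 Du); rewrite /dot2/= => /eqP.
  by rewrite addrC addr_eq0 dotNr => /eqP.
by have := bform_G0 G0q Gp; rewrite /dot2 /bform/= dotNr => /eqP; rewrite subr_eq0 =>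
  /eqP->; rewrite subrr.
Qed.

Lemma defect_graph_G0 p : E p -> G0 p -> p = 0.
Proof.
move=> [_ Ep] /Ep; rewrite (dot2_sqn dot_norm) => h.
by apply: sqn_eq0; apply: complexI.
Qed.

Lemma dotA_sqn u : dotA dot Dc Ac u u = (sqn (u, A u))%:C.
Proof. by rewrite -(dot2_sqn dot_norm) /dotA /dot2 addrC. Qed.

Lemma normA_sqr u : normA dot Dc Ac u ^+ 2 = (sqn (u, A u))%:C.
Proof. by rewrite sqrtCK dotA_sqn. Qed.

Lemma normA_ge0 u : 0 <= normA dot Dc Ac u.
Proof. by rewrite sqrtC_ge0 dotA_sqn lecR sqn_ge0. Qed.

Lemma normA_lt u (e : R) : 0 < e ->
  (normA dot Dc Ac u < e%:C) = (sqn (u, A u) < e ^+ 2).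
Proof.
move=> e0; rewrite -(@ltr_pXn2r _ 2)// ?nnegrE ?normA_ge0 ?lecR ?ltW//.
by rewrite normA_sqr -rmorphXn ltcR.
Qed.

Lemma normA_le1 u : (normA dot Dc Ac u <= 1) = (sqn (u, A u) <= 1).
Proof.
rewrite -(@ler_pXn2r _ 2)// ?nnegrE ?normA_ge0//.
by rewrite normA_sqr expr1n -[1]/(1%:C) lecR.
Qed.

Hypothesis Dmax_compact : compact_inclusion dot Dc Ac.

(** The compact inclusion controls only first components. By [defect_graph_rot] a second component
    is the first component of another defect element of the same norm, so both stay in a compact set
    after rescaling. *)
Lemma defect_cluster (p : nat -> H * H) (K : R) :
    (forall n, E (p n)) -> (forall n, sqn (p n) <= K) ->
  exists p0, E p0 /\ forall (e : R) N, 0 < e -> exists n, [/\ (N <= n)%N,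
    rnorm (p0.1 - (p n).1) < e & rnorm (p0.2 - (p n).2) < e].
Proof.
move=> Ep pK; have K0 : 0 <= K by apply: le_trans (pK 0); exact: sqn_ge0.
pose k := K + 1; have k0 : 0 < k by rewrite /k; lra.
have rk : complex.Re `|k%:C| = k.
  by rewrite normc_def/= expr0n addr0 sqrtr_sqr gtr0_norm.
have rkV : complex.Re `|k^-1%:C| = k^-1.
  by rewrite normc_def/= expr0n addr0 sqrtr_sqr gtr0_norm// invr_gt0.
pose q n := k^-1%:C *: p n.
have Eq n : E (q n) by exact: defect_graphZ.
have qp n : k%:C *: q n = p n.
  by rewrite /q scalerA -rmorphM divff ?scale1r// gt_eqF.
have q1 n : sqn (q n) <= 1.
  rewrite sqnZ rkV exprVn ler_pdivrMl ?exprn_gt0// mulr1.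
  by apply: le_trans (pK n) _; rewrite /k; nra.
pose B := [set u | Dmax dot Dc Ac u /\ normA dot Dc Ac u <= 1].
have EB r : E r -> sqn r <= 1 -> B r.1.
  move=> Er r1; split; first exact: (Dmax_adj_graph Er.1).
  by rewrite normA_le1 -(AmaxE Er.1).
have cB : compact (closure B) by move: Dmax_compact; rewrite /compact_inclusion precompactE.
have qB n : (closure B `*` closure B) (q n).
  split; apply: subset_closure; first exact: EB.
  apply: (EB ((q n).2, - (q n).1)); first exact: defect_graph_rot.
  by have := q1 n; rewrite /sqn/= rnormN addrC.
have [|r [_ rq]] := compact_setX cB cB (F := q @ \oo) _.
  by exists 0%N => // n _; exact: qB.
exists (k%:C *: r).
have clus e N : 0 < e -> exists n, [/\ (N <= n)%N,
    rnorm ((k%:C *: r).1 - (p n).1) < e & rnorm ((k%:C *: r).2 - (p n).2) < e].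
  move=> e0; have ek0 : 0 < e / k by rewrite divr_gt0.
  have [||_ [[n /= Nn <-] [/= h1 h2]]] := rq (q @` [set n | (N <= n)%N])
      ([set x | rnorm (r.1 - x) < e / k] `*` [set x | rnorm (r.2 - x) < e / k]).
  - by exists N => // n /= Nn; exists n.
  - exists ([set x | rnorm (r.1 - x) < e / k], [set x | rnorm (r.2 - x) < e / k]) => //.
    by split; apply/nbhs_rnorm; exists (e / k).
  exists n; split=> //; rewrite -qp /= -scalerBr rnormZ rk.
    by rewrite mulrC -ltr_pdivlMr.
  by rewrite mulrC -ltr_pdivlMr.
split=> //; apply: defect_graph_closed; apply/closure_rnorm => e e0.
by have [n [_ ? ?]] := clus e 0%N e0; exists (p n).
Qed.

(** * Eigenspaces of the adjoint below [m] *)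

Definition eigen_graph (l : R) p := G p /\ p.2 = l%:C *: p.1.

Definition eigen_perp (l : R) p :=
  G p /\ forall k, eigen_graph l k -> bform dot k p = 0.

Lemma eigen_graph_perp l p : eigen_graph l p -> eigen_perp l p.
Proof.
move=> [Gp ep]; split=> // k [_ ek].
by rewrite /bform ek ep dotZl dotZr conj_realC subrr.
Qed.

Lemma G0_eigen_perp l p : G0 p -> eigen_perp l p.
Proof.
move=> G0p; split=> [|k [Gk _]]; first exact: G0_adj_graph.
exact: bform_G0r.
Qed.

Lemma eigen_perp_sub l : linear_subspace (eigen_perp l).
Proof.
split; first by apply: G0_eigen_perp; exact: G0_sub.1.
move=> a p q [Gp hp] [Gq hq]; split; first exact: (adj_graph_sub _ _ _).2.
by move=> k ek; rewrite bformDr bformZr hp// hq// mulr0 addr0.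
Qed.

Lemma eigen_perp_closed l : closure (eigen_perp l) `<=` eigen_perp l.
Proof.
move=> p pS; split.
  by apply: (adj_graph_closed dot_norm); apply: closure_subset pS => q [].
by move=> k ek; apply: (bform_closure dot_norm) pS => q [_]; exact.
Qed.

(** The eigenspace is maximal isotropic modulo [G0]. Correcting [p] means solving
    [(A - l) r = (A - l) p] with [r] in [Dmin]: for [l < m] the shifted closure is coercive, and the
    complement of its range is [ker (A - l)], to which the right side is orthogonal by
    assumption. *)
Lemma eigen_perp_decomp l p : l < m -> eigen_perp l p ->
  exists2 q, G0 q & eigen_graph l (p + q).
Proof.
move=> lm [Gp pP].
have [|||r G0r rp] := @coercive_range _ _ _ dot_norm G0 l (m - l)
  (p.2 - l%:C *: p.1) G0_sub G0_closed.
- by rewrite subr_gt0.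
- move=> q /G0_rdot_ge; rewrite rdotDl rdotNl rdotZl -(rnorm_sqr dot_norm).
  by lra.
- move=> z zP; have Gz : G (z, l%:C *: z).
    move=> u Du; have := zP _ (Dc_G0 Du); rewrite /= dotBl dotZl => /eqP.
    by rewrite subr_eq0 => /eqP->; rewrite dotZr conj_realC.
  have := pP (z, l%:C *: z) (conj Gz erefl); rewrite /bform/= dotZl => h.
  rewrite dotC dotBr dotZr conj_realC.
  by rewrite -opprB h oppr0 rmorph0.
exists (- r); first by rewrite -scaleN1r; exact: G0Z.
split; first by apply: adj_graphB => //; exact: G0_adj_graph.
have -> : (p - r).2 = r.2 - l%:C *: r.1 + l%:C *: p.1 - r.2.
  by rewrite rp subrK.
by rewrite -[r.2 - _ + _]addrA [r.2 + _]addrC addrK addrC scalerBr.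
Qed.

Lemma Re_bform_small p q (d : R) : rnorm q.1 <= d -> rnorm q.2 <= d ->
  `|complex.Re (bform dot p q)| <= d * (rnorm p.1 + rnorm p.2).
Proof.
move=> q1 q2; have -> : complex.Re (bform dot p q) = rdot2 dot (- q.2, q.1) p.
  by rewrite /bform cReB /rdot2/= rdotNl (rdotC dot q.2) (rdotC dot q.1) addrC.
by apply: (rdot2_abs dot_norm); rewrite //= rnormN.
Qed.

(* The eigenspaces of the adjoint at [l -> -oo] accumulate on the whole
   Friedrichs domain modulo [Dmin]: they are Lagrangian, so the component of
   [p0] orthogonal to one of them is a rotated element of it, and such elements
   can only cluster inside the Friedrichs domain, which is isotropic. *)
Lemma friedrichs_eigen_approx p0 : E p0 -> form_bounded_limit p0.1 ->
  forall e z : R, 0 < e -> exists l k q,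
    [/\ l < z, E k, G0 q, eigen_graph l (k + q) & sqn (p0 - k) < e].
Proof.
move=> E0 F0 e z e0; apply: contrapT => no.
(* Strictly below both [z] and [m], and tending to minus infinity. *)
pose l n : R := Num.min z m - n.+1%:R.
have lz n : l n < z.
  rewrite /l ltrBlDr; apply: le_lt_trans (_ : z < _); first by rewrite ge_min lexx.
  by rewrite ltrDl.
have lm n : l n < m.
  rewrite /l ltrBlDr; apply: le_lt_trans (_ : m < _); first by rewrite ge_min lexx orbT.
  by rewrite ltrDl.
have /choice[L LP] n : exists L, [/\ E L, exists2 q, G0 q & eigen_graph (l n) (L + q),
    sqn L <= sqn p0 & complex.Re (bform dot p0 L) <= - e].
  have [s [/eigen_perp_closed Ss sP]] :=
    projection dot_norm p0 (eigen_perp_sub (l n)).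
  set r := p0 - s in sP.
  have Er : E r.
    split=> [|q G0q]; first exact: adj_graphB E0.1 Ss.1.
    by apply: sP; exact: G0_eigen_perp.
  have sr : s = p0 - r by rewrite /r subKr.
  have pr : p0 = s + r by rewrite sr subrK.
  have eps : p0 - s = r by [].
  clearbody r.
  (* Otherwise [s], which lies in the eigenspace modulo [G0], would be the approximation excluded by
     [no]. *)
  have er : e <= sqn r.
    rewrite leNgt; apply/negP => re; apply: no.
    have [q G0q sq] := eigen_perp_decomp (lm n) Ss.
    exists (l n), s, q; rewrite eps; split=> //.
    by rewrite sr; exact: defect_graphB.
  (* Rotation turns orthogonality to the eigenspace into annihilation by [bform], so the rotated [r]
     lies in the eigenspace modulo [G0]; its pairing with [p0] is [- sqn r]. *)
  have EL : E (- r.2, r.1).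
    have := defect_graphZ (- 1) (defect_graph_rot Er).
    by rewrite !scaleN1r -[- (r.2, - r.1)]/(- r.2, - - r.1) opprK.
  have rs := sP _ Ss.
  exists (- r.2, r.1); split=> //.
  - apply: eigen_perp_decomp; first exact: lm.
    split=> [|k ek]; first exact: EL.1.
    have := sP _ (eigen_graph_perp ek); rewrite /dot2 /bform/= dotNr => h.
    by rewrite -opprD addrC h oppr0.
  - have -> : sqn (- r.2, r.1) = sqn r by rewrite /sqn/= rnormN addrC.
    have h : rdot dot s.1 r.1 + rdot dot s.2 r.2 = 0 by rewrite /rdot -cReD [_ + _]rs.
    rewrite -subr_ge0.
    have -> : sqn p0 - sqn r = sqn s.
      rewrite pr.
      rewrite !(sqn_rdot2 dot_norm) /rdot2/= !rdotE.
      by rewrite (rdotC dot r.1 s.1) (rdotC dot r.2 s.2); lra.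
    exact: sqn_ge0.
  have -> : bform dot p0 (- r.2, r.1) = - dot2 dot p0 r.
    by rewrite /bform /dot2/= dotNr; ring.
  have -> : dot2 dot p0 r = (sqn r)%:C.
    rewrite pr.
    rewrite -(dot2_sqn dot_norm) -[RHS]add0r -rs /dot2/= !dotDl; ring.
  by rewrite cReN/= lerN2.
have EL n : E (L n) by case: (LP n).
have [|L0 [EL0 clus]] := defect_cluster EL (K := sqn p0).
  by move=> n; case: (LP n).
have F1 : form_bounded_limit L0.1.
  apply: (@low_energy_form_dom _ (sqn p0)) => d T d0.
  have [N NP] : exists N, forall n, (N <= n)%N -> l n <= - T.
    exists (Num.truncn `|Num.min z m + T|) => n Nn.
    have := truncnS_gt `|Num.min z m + T|; have := ler_norm (Num.min z m + T).
    have : (Num.truncn `|Num.min z m + T|).+1%:R <= n.+1%:R :> R by rewrite ler_nat.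
    by rewrite /l; set k : R := n.+1%:R; set k' : R := _.+1%:R; lra.
  have [n [Nn h1 _]] := clus d N d0.
  have [_ [q G0q [_ qe]] Ls _] := LP n.
  exists (L n), q; split=> //; first exact: (EL n).1.
  have -> : (L n).2 + q.2 = (l n)%:C *: ((L n).1 + q.1) by exact: qe.
  rewrite rdotZl -(rnorm_sqr dot_norm) ler_wpM2r ?sqr_ge0//.
  exact: NP.
(* Isotropy makes the pairing of [p0] with the cluster point zero, whereas every [L n] pairs with
   [p0] to at most [- e]. *)
have B0 := form_dom_isotropic E0.1 EL0.1 F0 F1.
pose b := rnorm p0.1 + rnorm p0.2 + 1.
have b0 : 0 < b by rewrite /b; have := rnorm_ge0 p0.1; have := rnorm_ge0 p0.2; lra.
have eb0 : 0 < e / b by rewrite divr_gt0.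
have [n [_ h1 h2]] := clus _ 0%N eb0.
have := @Re_bform_small p0 (L0 - L n) _ (ltW h1) (ltW h2).
rewrite bformBr B0 sub0r cReN normrN.
have [_ _ _ h3] := LP n.
have h4 : e / b * (rnorm p0.1 + rnorm p0.2) < e.
  rewrite -mulrA gtr_pMr// ltr_pdivrMl// mulr1 /b; lra.
by rewrite ler_norml => /andP[h5 _]; lra.
Qed.

(** * Selfadjoint domains as Lagrangian subspaces *)

Definition lift u : H * H := (u, A u).

Lemma lift_fst p : G p -> lift p.1 = p.
Proof. by move=> /AmaxE pE; rewrite [RHS]pE. Qed.

(** Maximality is taken modulo [G0], so that [L] can lie in the defect graph without containing
    [G0]. *)
Definition lagrangian (L : set (H * H)) :=
  (forall p q, L p -> L q -> bform dot p q = 0) /\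
  (forall v : H * H, G v -> (forall p, L p -> bform dot p v = 0) ->
     exists p q, [/\ L p, G0 q & v = p + q]).

(** The graph over [D + Dmin] is the lift of [D] plus [G0]. It contains the graph of [Ac], so its
    adjoint graph is its [bform] annihilator inside [G]; selfadjointness says that it equals this
    annihilator. *)
Lemma selfadjoint_lagrangian (D : set H) : linear_subspace D ->
    D `<=` defect_space dot Dc Ac ->
  selfadjoint dot (add_space D (Dmin Dc Ac)) A <-> lagrangian (lift @` D).
Proof.
move=> [D0 Dlin] DE.
have GD x : D x -> G (lift x) by move=> /DE/defect_spaceP[].
have W_lift x w : D x -> Dmin Dc Ac w -> lift (x + w) = lift x + lift w.
  move=> Dx /DminP/G0_adj_graph Gw.
  by rewrite -[RHS]lift_fst//; apply: adj_graphD => //; exact: GD.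
have Dmin0 : Dmin Dc Ac 0 by exact: (Dmin_G0 G0_sub.1).
split=> [[_ adjE]|[Liso Lmax]].
  split=> [_ _ [x Dx <-] [y Dy <-]|v Gv vP].
    have : op_graph (add_space D (Dmin Dc Ac)) A (lift y).
      by split=> //; exists y => //; exists 0 => //; rewrite addr0.
    rewrite -adjE => /adj_graph_bform; apply.
    by exists x => //; exists 0 => //; rewrite addr0.
  have : adj_graph dot (add_space D (Dmin Dc Ac)) A v.
    apply/adj_graph_bform => _ [x Dx [w Dw <-]].
    rewrite -/(lift _) W_lift// bformDl vP; last by exists x.
    by rewrite add0r; apply: bform_G0 => //; apply/DminP.
  rewrite adjE => -[[x Dx [w Dw xw]] _].
  exists (lift x), (lift w); split; [by exists x|by apply/DminP|].
  by rewrite -W_lift// xw lift_fst.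
split.
  move=> O [u Ou] Oo; have [|v [Ov Dv]] := Dc_dense _ Oo; first by exists u.
  exists v; split=> //; exists 0 => //; exists v; rewrite ?add0r//.
  by apply/DminP; rewrite Amax_Dc//; exact: Dc_G0.
rewrite eqEsubset; split=> [v vW|v [[x Dx [w Dw xw]] v2]].
  have Gv : G v.
    apply/adj_graph_bform => u Du; rewrite -Amax_Dc//.
    move/adj_graph_bform : vW; apply; exists 0 => //; exists u; rewrite ?add0r//.
    by apply/DminP; rewrite Amax_Dc//; exact: Dc_G0.
  have [|_ [q [[x Dx <-] G0q vE]]] := Lmax v Gv.
    move=> _ [x Dx <-]; move/adj_graph_bform : vW; apply.
    by exists x => //; exists 0 => //; rewrite addr0.
  split; last by rewrite {1}(AmaxE Gv).
  by exists x => //; exists q.1; [exact: Dmin_G0|rewrite vE].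
have -> : v = lift x + lift w by rewrite -W_lift// xw /lift -v2; case: (v).
apply/adj_graph_bform => _ [y Dy [z Dz <-]]; rewrite -/(lift _) W_lift//.
have G0w : G0 (lift w) by apply/DminP.
have G0z : G0 (lift z) by apply/DminP.
rewrite !bformE Liso; [|by exists y|by exists x].
rewrite (bform_G0 G0z (GD _ Dx)) (bform_G0r G0w (GD _ Dy)).
by rewrite (bform_G0 G0z (G0_adj_graph G0w)) !addr0.
Qed.

(** * Moving a Lagrangian subspace onto a prescribed vector *)

Section Transport.
Variables (L : set (H * H)) (e0 p k : H * H) (nu : R).
Hypothesis L_sub : linear_subspace L.
Hypothesis L_lag : lagrangian L.
Hypothesis Le0 : L e0.
Hypothesis Gp : G p.
Hypothesis Gk : G k.
Hypothesis nu0 : nu != 0.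
Hypothesis e0p : bform dot e0 p = nu%:C.
Hypothesis pp : bform dot p p = 0.
Hypothesis kk : bform dot k k = 0.
Hypothesis pk : bform dot p k != 0.

(** The coefficient at [e0] for which the remainder [transport_rest] annihilates [p]. *)
Definition transport_coef z := bform dot z p / nu%:C.
Definition transport_rest z := z - transport_coef z *: e0.
(** The multiple of [p] to subtract from the remainder so that it annihilates [k]. *)
Definition transport_shift z := bform dot (transport_rest z) k / bform dot p k.

(* A linear map close to the identity when [k] is close to [e0], sending [e0]
   to [k] and Lagrangian subspaces through [e0] to Lagrangian ones. *)
Definition transport z :=
  transport_coef z *: k + transport_rest z - transport_shift z *: p.

Let nuC0 : nu%:C != 0.
Proof. by rewrite eq_complex/= negb_and nu0. Qed.

Let pe0 : bform dot p e0 = - nu%:C.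
Proof. by rewrite bform_skew e0p conj_realC. Qed.

Let bform0_sym (u v : H * H) : bform dot u v = 0 -> bform dot v u = 0.
Proof. by move=> uv; rewrite bform_skew uv rmorph0 oppr0. Qed.

Lemma transport_coef_lin a (z w : H * H) :
  transport_coef (a *: z + w) = a * transport_coef z + transport_coef w.
Proof. by rewrite /transport_coef bformDl bformZl; field. Qed.

Lemma transport_rest_lin a (z w : H * H) :
  transport_rest (a *: z + w) = a *: transport_rest z + transport_rest w.
Proof.
rewrite /transport_rest transport_coef_lin scalerDl scalerBr scalerA opprD.
by rewrite addrACA.
Qed.

Lemma transport_lin a (z w : H * H) : transport (a *: z + w) = a *: transport z + transport w.
Proof.
rewrite /transport transport_coef_lin transport_rest_lin.
have -> : transport_shift (a *: z + w) = a * transport_shift z + transport_shift w.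
  by rewrite /transport_shift transport_rest_lin bformDl bformZl; field.
rewrite !scalerDl opprD [X in X + _ = _]addrACA [LHS]addrACA; congr (_ + _).
by rewrite -!scalerA -scalerDr -scalerBr.
Qed.

Lemma transport_rest_L z : L z -> L (transport_rest z).
Proof.
move=> Lz; rewrite /transport_rest addrC -scaleNr; exact: L_sub.2.
Qed.

Lemma transport_rest_p z : bform dot (transport_rest z) p = 0.
Proof.
by rewrite /transport_rest bformBl bformZl e0p /transport_coef divfK ?subrr.
Qed.

Lemma transport_shift_k z :
  bform dot (transport_rest z) k - transport_shift z * bform dot p k = 0.
Proof. by rewrite /transport_shift divfK ?subrr. Qed.

Lemma transport_e0 : transport e0 = k.
Proof.
have c1 : transport_coef e0 = 1 by rewrite /transport_coef e0p divff.
have r0 : transport_rest e0 = 0 by rewrite /transport_rest c1 scale1r subrr.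
have s0 : transport_shift e0 = 0.
  by rewrite /transport_shift r0 -(scale0r 0) bformZl !mul0r.
by rewrite /transport c1 r0 s0 scale1r scale0r addr0 subr0.
Qed.

Lemma transport_pperp z : bform dot z p = 0 ->
  transport z = z - (bform dot z k / bform dot p k) *: p.
Proof.
move=> zp; have c0 : transport_coef z = 0 by rewrite /transport_coef zp mul0r.
have r0 : transport_rest z = z by rewrite /transport_rest c0 scale0r subr0.
by rewrite /transport /transport_shift c0 r0 scale0r add0r.
Qed.

Lemma transport_inj z : L z -> transport z = 0 -> z = 0.
Proof.
move=> Lz Tz.
have kp : bform dot k p != 0 by rewrite bform_skew oppr_eq0 conjC_eq0.
have c0 : transport_coef z = 0.
  have : bform dot (transport z) p = 0 by rewrite Tz -(scale0r 0) bformZl mul0r.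
  rewrite /transport bformBl bformDl !bformZl transport_rest_p pp mulr0 subr0 addr0.
  by move/eqP; rewrite mulf_eq0 (negbTE kp) orbF => /eqP.
have zp : bform dot z p = 0.
  by move/eqP : c0; rewrite mulf_eq0 invr_eq0 (negbTE nuC0) orbF => /eqP.
(* Now [z] is a multiple of [p]; isotropy of [L] against [e0], which pairs nontrivially with [p],
   makes it zero. *)
move: Tz; rewrite transport_pperp// => /eqP; rewrite subr_eq0 => /eqP zE.
have := L_lag.1 _ _ Le0 Lz; rewrite zE bformZr e0p => /eqP.
by rewrite mulf_eq0 (negbTE nuC0) orbF conjC_eq0 => /eqP->; rewrite scale0r.
Qed.

(** [k] and [p] are isotropic, the remainders annihilate [p] and each other, and the shifts cancel
    their pairings with [k]. *)
Lemma transport_iso (z w : H * H) : L z -> L w -> bform dot (transport z) (transport w) = 0.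
Proof.
move=> Lz Lw; rewrite /transport.
have zk := transport_shift_k z; have wk := transport_shift_k w.
have kw : bform dot k (transport_rest w) -
    Num.conj (transport_shift w) * bform dot k p = 0.
  rewrite bform_skew (bform_skew _ p k) mulrN opprK.
  by rewrite -rmorphM addrC -rmorphB -opprB wk oppr0 rmorph0.
have zw := L_lag.1 _ _ (transport_rest_L Lz) (transport_rest_L Lw).
have zp := transport_rest_p z; have pw := bform0_sym (transport_rest_p w).
move: (transport_rest z) (transport_rest w) (transport_shift z)
  (transport_shift w) zk kw zw zp pw {wk} => rz rw sz sw zk kw zw zp pw.
rewrite !bformE kk pp zw zp pw.
move/eqP : kw; rewrite subr_eq0 => /eqP ->.
move/eqP : zk; rewrite subr_eq0 => /eqP ->.
by ring.
Qed.

(** For maximality, [v] is changed by multiples of [k] and [p] into [v2], which annihilates [L].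
    Maximality of [L] gives [v2 = x + q], and [v] is the image of [c *: e0 + x] plus [q]. *)
Lemma transport_lagrangian : lagrangian (transport @` L).
Proof.
split=> [_ _ [z Lz <-] [w Lw <-]|v Gv vP]; first exact: transport_iso.
have kp : bform dot k p != 0 by rewrite bform_skew oppr_eq0 conjC_eq0.
have kv : bform dot k v = 0 by apply: vP; exists e0 => //; exact: transport_e0.
have vk := bform0_sym kv.
pose c := bform dot v p / bform dot k p.
pose v1 := v - c *: k.
have v1p : bform dot v1 p = 0 by rewrite /v1 bformBl bformZl /c divfK ?subrr.
have v1k : bform dot v1 k = 0 by rewrite /v1 bformBl bformZl kk vk mulr0 subr0.
pose al := bform dot v1 e0 / nu%:C.
pose v2 := v1 + al *: p.
have v2p : bform dot v2 p = 0 by rewrite /v2 bformDl bformZl pp mulr0 addr0.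
have v2e0 : bform dot v2 e0 = 0.
  by rewrite /v2 bformDl bformZl pe0 /al mulrN divfK ?subrr.
have Gv1 : G v1 by apply: adj_graphB => //; exact: adj_graphZ.
have Gv2 : G v2 by apply: adj_graphD => //; exact: adj_graphZ.
have [z Lz|x [q [Lx G0q v2E]]] := L_lag.2 v2 Gv2.
  have -> : z = transport_rest z + transport_coef z *: e0 by rewrite subrK.
  rewrite bformDl bformZl (bform0_sym v2e0) mulr0 addr0.
  have Lr := transport_rest_L Lz; have rp := transport_rest_p z.
  set r := transport_rest z in Lr rp *.
  have Tr := transport_pperp rp; set be := _ / _ in Tr.
  have rE : r = transport r + be *: p by rewrite Tr subrK.
  have Trv : bform dot (transport r) v = 0 by apply: vP; exists r.
  have Trp : bform dot (transport r) p = 0 by rewrite Tr bformBl bformZl rp pp mulr0 subr0.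
  have Trk : bform dot (transport r) k = 0.
    by rewrite Tr bformBl bformZl /be divfK ?subrr.
  have Trv2 : bform dot (transport r) v2 = 0.
    rewrite /v2 bformDr bformZr Trp mulr0 addr0 /v1 bformBr bformZr Trv Trk.
    by rewrite mulr0 subr0.
  have pv2 : bform dot p v2 = 0.
    by rewrite /v2 bformDr bformZr pp mulr0 addr0 (bform0_sym v1p).
  by rewrite rE bformDl bformZl Trv2 pv2 mulr0 addr0.
have xp : bform dot x p = 0.
  have := v2p; rewrite v2E bformDl (bform_G0 G0q Gp) addr0; exact.
have xk : bform dot x k = al * bform dot p k.
  have : bform dot v2 k = al * bform dot p k by rewrite /v2 bformDl bformZl v1k add0r.
  by rewrite v2E bformDl (bform_G0 G0q Gk) addr0.
exists (transport (c *: e0 + x)), q; split=> //.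
  by exists (c *: e0 + x) => //; exact: L_sub.2.
rewrite transport_lin transport_e0 (transport_pperp xp) xk mulfK//.
have -> : v = c *: k + v1 by rewrite /v1 addrC subrK.
have -> : v1 = v2 - al *: p by rewrite /v2 addrK.
by rewrite v2E -!addrA; congr (_ + (_ + _)); rewrite addrC.
Qed.

End Transport.

(** The displacement is a multiple of [k - e0] minus the shift times [p]. The shift is small because
    the remainder annihilates [e0], so its pairing with [k] sees only [e0 - k]. *)
Lemma transport_near (e0 p : H * H) (nu B et : R) : 0 < nu -> 0 <= B -> 0 < et ->
    bform dot e0 p = nu%:C ->
  exists2 dl : R, 0 < dl & forall k, norm1 (e0 - k) < dl ->
    bform dot p k != 0 /\ forall z, norm1 z <= B ->
      bform dot (transport_rest e0 p nu z) e0 = 0 ->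
      norm1 (transport e0 p k nu z - z) < et.
Proof.
move=> nu0 B0 et0 e0p.
pose P := norm1 p + norm1 e0.
have p0 := norm1_ge0 p; have e00 := norm1_ge0 e0.
have P0 : 0 <= P by rewrite /P addr_ge0.
pose c := 2 * (B * P) / nu.
have c0 : 0 <= c by rewrite /c divr_ge0 ?mulr_ge0// ltW.
pose B1 := B + c * P.
have B10 : 0 <= B1 by rewrite /B1 addr_ge0// mulr_ge0.
pose C := c + 4 * (B1 * P) / nu.
have C0 : 0 <= C by rewrite /C addr_ge0// divr_ge0 ?mulr_ge0// ltW.
(* The first bound keeps the modulus of [bform dot p k] above [nu / 2]; the second makes the
   displacement, at most [C] times the distance, smaller than [et]. *)
pose dl := Num.min (nu / (4 * P + 1)) (et / (C + 1)).
have P41 : 0 < 4 * P + 1 by lra.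
have C1 : 0 < C + 1 by lra.
exists dl; first by rewrite lt_min !divr_gt0.
move=> k; rewrite lt_min => /andP[ek1 ek2]; set ka := norm1 (e0 - k) in ek1 ek2.
have ka0 : 0 <= ka by exact: norm1_ge0.
have pk : nu / 2 <= cabs (bform dot p k).
  have h := cabs_bform dot_norm p (e0 - k); rewrite -/ka in h.
  have pe0 : cabs (bform dot p e0) = nu.
    by rewrite bform_skew e0p conj_realC cabsN cabs_real gtr0_norm.
  have := cabsD (bform dot p (e0 - k)) (bform dot p k).
  rewrite -bformDr subrK pe0.
  have : ka * (4 * P + 1) < nu by rewrite -ltr_pdivlMr.
  have : norm1 p <= P by rewrite /P; lra.
  by nra.
have pk0 : 0 < cabs (bform dot p k) by apply: lt_le_trans pk; lra.
split; first by apply: contraTneq pk0 => ->; rewrite normr0/= ltxx.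
move=> z zB ze0.
set cz := transport_coef p nu z; set z1 := transport_rest e0 p nu z.
have czc : cabs cz <= c.
  rewrite /cz /transport_coef cabsM cabsV cabs_real (gtr0_norm nu0).
  rewrite /c ler_pM2r ?invr_gt0//; apply: le_trans (cabs_bform dot_norm _ _) _.
  by rewrite ler_pM2l// ler_pM ?norm1_ge0// /P; lra.
have cz0 : 0 <= cabs cz by exact: cabs_ge0.
have z1B : norm1 z1 <= B1.
  apply: le_trans (norm1B _ _) _; rewrite norm1Z -/cz /B1 lerD//.
  by rewrite ler_pM// /P; lra.
have -> : transport e0 p k nu z - z =
    cz *: (k - e0) - transport_shift e0 p k nu z *: p.
  rewrite /transport -/cz /transport_rest -/cz scalerBr.
  rewrite addrAC; congr (_ - _).
  by rewrite -addrA; congr (_ + _); rewrite addrAC subrr add0r.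
have sh : cabs (transport_shift e0 p k nu z) <= 4 * B1 / nu * ka.
  rewrite /transport_shift -/z1 cabsM cabsV.
  have -> : bform dot z1 k = - bform dot z1 (e0 - k).
    by rewrite bformBr /z1 ze0 sub0r opprK.
  rewrite cabsN ler_pdivrMr//.
  have h := cabs_bform dot_norm z1 (e0 - k); rewrite -/ka in h.
  apply: le_trans h _.
  apply: le_trans (_ : 2 * (B1 * ka) <= _); first by rewrite ler_pM2l// ler_wpM2r.
  apply: le_trans (_ : 4 * B1 / nu * ka * (nu / 2) <= _).
    by have -> : 4 * B1 / nu * ka * (nu / 2) = 2 * (B1 * ka) by field; rewrite gt_eqF.
  by rewrite ler_wpM2l// !mulr_ge0// ?invr_ge0 ltW.
apply: le_lt_trans (norm1B _ _) _; rewrite !norm1Z.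
have -> : norm1 (k - e0) = ka by rewrite -norm1N opprB.
apply: le_lt_trans (_ : C * ka < _).
  have -> : C * ka = c * ka + 4 * B1 / nu * ka * P by rewrite /C; ring.
  by rewrite lerD// ler_pM ?cabs_ge0// /P; lra.
apply: le_lt_trans (_ : (C + 1) * ka < _); first by rewrite ler_wpM2r//; lra.
by rewrite mulrC -ltr_pdivlMr.
Qed.

(** * Frames and the topology of the Grassmannian *)

Section Families.
Variable d : nat.
Implicit Types (f g : 'I_d -> H) (b : 'I_d -> R[i]).

Lemma defect_graph_sum (F : 'I_d -> H * H) b :
  (forall i, E (F i)) -> E (\sum_i b i *: F i).
Proof.
move=> EF; apply: (big_ind E) => [|p q Ep Eq|i _].
- exact: defect_graph0.
- exact: defect_graphD.
- exact: defect_graphZ.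
Qed.

Lemma fst_sum (F : 'I_d -> H * H) b :
  (\sum_i b i *: F i).1 = \sum_i b i *: (F i).1.
Proof. by apply: (big_morph (fun p : H * H => p.1)). Qed.

Lemma lift_sum f b : (forall i, defect_space dot Dc Ac (f i)) ->
  lift (\sum_i b i *: f i) = \sum_i b i *: lift (f i).
Proof.
move=> fE; have EF : E (\sum_i b i *: lift (f i)).
  by apply: defect_graph_sum => i; apply/defect_spaceP.
by rewrite -[RHS](lift_fst EF.1) fst_sum.
Qed.

Lemma fam_span_sub f : linear_subspace (fam_span f).
Proof.
split; first by exists (fun=> 0) => //; rewrite big1// => i _; rewrite scale0r.
move=> a _ _ [b _ <-] [c _ <-]; exists (fun i => a * b i + c i) => //.
rewrite scaler_sumr -big_split/=; apply: eq_bigr => i _.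
by rewrite scalerDl scalerA.
Qed.

Lemma fam_span_mem f i : fam_span f (f i).
Proof.
exists (fun j => (j == i)%:R) => //.
rewrite (bigD1 i)//= eqxx scale1r big1 ?addr0// => j /negbTE->.
by rewrite scale0r.
Qed.

Lemma fam_span_defect f : (forall i, defect_space dot Dc Ac (f i)) ->
  fam_span f `<=` defect_space dot Dc Ac.
Proof.
move=> fE _ [b _ <-]; apply/defect_spaceP; rewrite -/(lift _) lift_sum//.
by apply: defect_graph_sum => i; apply/defect_spaceP.
Qed.

Lemma Gr_frame (D : set H) : Gr dot Dc Ac d D ->
  exists2 f : 'I_d -> H, frame dot Dc Ac f & D = fam_span f.
Proof.
move=> [_ DE [f [Df ffree DS]]]; exists f.
  by split=> // i; apply: DE.
rewrite DS eqEsubset; split=> [_ [_ -> [x fx <-]]|x fx]; first by rewrite add0r.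
by exists 0 => //; exists x => //; rewrite add0r.
Qed.

Lemma frame_Gr f : frame dot Dc Ac f -> Gr dot Dc Ac d (fam_span f).
Proof.
move=> [fE ffree]; split; [exact: fam_span_sub|exact: fam_span_defect|].
exists f; split=> // [i|]; first exact: fam_span_mem.
rewrite eqEsubset; split=> [x fx|_ [_ -> [x fx <-]]]; last by rewrite add0r.
by exists 0 => //; exists x => //; rewrite add0r.
Qed.

(* The coefficients are recovered by inverting the Gram matrix. *)
Lemma frame_coef_bound f : frame dot Dc Ac f -> exists2 K : R, 0 < K &
  forall b i, cabs (b i) <= K * norm1 (\sum_j b j *: lift (f j)).
Proof.
move=> [fE ffree].
pose F i := lift (f i).
pose M := \matrix_(i, j) dot2 dot (F i) (F j).
have dotS b j : dot2 dot (\sum_i b i *: F i) (F j) = \sum_i b i * M i j.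
  apply: etrans (_ : \sum_i dot2 dot (b i *: F i) (F j) = _).
    apply: (big_morph (fun p : H * H => dot2 dot p (F j))) => [p q|].
      by rewrite /dot2 !dotDl addrACA.
    by rewrite /dot2 !dot0l addr0.
  by apply: eq_bigr => i _; rewrite mxE /dot2 !dotZl mulrDr.
(* A combination killed by the Gram matrix is orthogonal to every frame vector, hence to itself, and
   freeness applies. *)
have Mu : M \in unitmx.
  rewrite -row_free_unit; apply: inj_row_free => v vM.
  pose b i := v 0 i; pose X := \sum_i b i *: F i.
  have XF j : dot2 dot X (F j) = 0.
    by rewrite dotS; move/rowP : vM => /(_ j); rewrite !mxE.
  have XX : dot2 dot X X = 0.
    rewrite {2}/X; apply: etrans (_ : \sum_j dot2 dot X (b j *: F j) = _).
      apply: (big_morph (fun p : H * H => dot2 dot X p)) => [p q|].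
        by rewrite /dot2 !dotDr addrACA.
      by rewrite /dot2 !dot0r addr0.
    rewrite big1// => j _; have := XF j; rewrite /dot2 !dotZr -mulrDr => ->.
    by rewrite mulr0.
  have X0 : X = 0.
    by apply: sqn_eq0; apply: complexI; rewrite -(dot2_sqn dot_norm).
  apply/rowP => i; rewrite mxE; apply: (ffree b) => /=.
  by rewrite -[LHS](fst_sum F) -/X X0.
pose K := 1 + \sum_i \sum_j 2 * norm1 (F j) * cabs (invmx M j i).
have K0 i j : 0 <= 2 * norm1 (F j) * cabs (invmx M j i).
  by rewrite mulr_ge0 ?cabs_ge0// mulr_ge0// norm1_ge0.
exists K; first by rewrite ltr_pwDl// sumr_ge0// => i _; rewrite sumr_ge0.
move=> b i; set X := \sum_j _.
have bE : b i = \sum_j dot2 dot X (F j) * invmx M j i.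
  have : (\row_j b j) *m M *m invmx M = \row_j b j by rewrite mulmxK.
  move/rowP => /(_ i); rewrite !mxE => <-; apply: eq_bigr => j _.
  by rewrite dotS mxE; congr (_ * _); apply: eq_bigr => k _; rewrite mxE.
have csum (s : 'I_d -> R[i]) : cabs (\sum_j s j) <= \sum_j cabs (s j).
  apply: (big_ind2 (fun (x : R[i]) (y : R) => is_true (cabs x <= y))) => //.
    by rewrite normr0.
  by move=> x1 x2 y1 y2 h1 h2; apply: le_trans (cabsD _ _) _; exact: lerD.
rewrite bE; apply: le_trans (csum _) _.
apply: le_trans (_ : (\sum_j 2 * norm1 (F j) * cabs (invmx M j i)) * norm1 X <= _).
  rewrite mulr_suml; apply: ler_sum => j _.
  rewrite cabsM mulrAC ler_wpM2r ?cabs_ge0//.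
  by apply: le_trans (cabs_dot2 dot_norm _ _) _; rewrite mulrAC -mulrA.
apply: ler_wpM2r; first exact: norm1_ge0.
rewrite /K [X in _ <= 1 + X](bigD1 i)//= addrCA lerDl addr_ge0//.
by apply: sumr_ge0 => k _; apply: sumr_ge0 => j _; exact: K0.
Qed.

Lemma norm1_sum (F : 'I_d -> H * H) (s : 'I_d -> R) :
  (forall i, norm1 (F i) <= s i) -> norm1 (\sum_i F i) <= \sum_i s i.
Proof.
move=> h; apply: (big_ind2 (fun (x : H * H) (y : R) => is_true (norm1 x <= y))) => //.
  by rewrite /norm1 rnorm0 addr0.
by move=> x1 x2 y1 y2 h1 h2; apply: le_trans (norm1D _ _) _; exact: lerD.
Qed.

Variable D : set H.
Hypothesis D_SA : SA dot Dc Ac d D.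

Let D_sub : linear_subspace D. Proof. by case: D_SA.1. Qed.
Let D_defect : D `<=` defect_space dot Dc Ac. Proof. by case: D_SA.1. Qed.

Let D_lag : lagrangian (lift @` D).
Proof. by apply/selfadjoint_lagrangian => //; exact: D_SA.2. Qed.

Let GD x : D x -> E (lift x).
Proof. by move=> /D_defect/defect_spaceP. Qed.

Let lift_D_sub : linear_subspace (lift @` D).
Proof.
have [D0 Dlin] := D_sub; split.
  exists 0 => //; apply: (lift_fst (p := 0)); exact: (adj_graph_sub _ _ _).1.
move=> a _ _ [x Dx <-] [y Dy <-]; exists (a *: x + y); first exact: Dlin.
rewrite -[RHS]lift_fst//; apply: (adj_graph_sub _ _ _).2; exact: (GD _).1.
Qed.

(** * Instability when [D] meets the Friedrichs domain outside [Dmin] *)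

Lemma friedrichs_unstable u : add_space D (Dmin Dc Ac) u ->
  friedrichs_dom dot Dc Ac m u -> ~ Dmin Dc Ac u ->
  spectrally_unstable dot Dc Ac d D.
Proof.
move=> [x Dx [w Dw xw]] [_ /friedrichs_form_domP Fu] nDu U.
case=> USA; case=> Om; case=> OGr Oopen; case=> OD OU z.
have G0w : G0 (lift w) by apply/DminP.
have Fx : form_bounded_limit x.
  have -> : x = u + (-1) *: w by rewrite -xw scaleN1r addrK.
  apply: form_bounded_limitD => //; apply: form_bounded_limitZ.
  exact: (form_bounded_limit_G0 G0w).
pose e0 := lift x; have Ee0 : E e0 by exact: GD.
have e00 : 0 < sqn e0.
  rewrite lt_neqAle sqn_ge0 andbT eq_sym; apply/eqP => /sqn_eq0 e00; apply: nDu.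
  have x0 : x = 0 by have := congr1 fst e00.
  by rewrite -xw x0 add0r.
(* The rotated [e0] pairs with [e0] to [sqn e0] and is isotropic like [e0], as [transport]
   requires. *)
pose p := (e0.2, - e0.1); have Ep : E p by exact: defect_graph_rot.
have e0p : bform dot e0 p = (sqn e0)%:C.
  by rewrite -(dot2_sqn dot_norm) /bform /dot2/= dotNr opprK addrC.
have Le0 : (lift @` D) e0 by exists x.
have pp : bform dot p p = 0.
  by rewrite -(D_lag.1 _ _ Le0 Le0) /bform/= dotNl dotNr opprK addrC.
have [f [fE ffree] Df] := Gr_frame D_SA.1.
have [e e_gt0 eO] := Oopen f (conj fE ffree) (eq_ind _ Om OD _ Df).
have re0 : 0 < complex.Re e by rewrite -ltcR ge0_Re// ltW.
pose B := \sum_i norm1 (lift (f i)).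
have B0 : 0 <= B by rewrite sumr_ge0// => i _; exact: norm1_ge0.
have [dl dl0 near] := transport_near e00 B0 re0 e0p.
have d20 : 0 < (dl / 2) ^+ 2 by rewrite exprn_gt0// divr_gt0.
have [l [k [q [lz Ek G0q kq ek]]]] := friedrichs_eigen_approx Ee0 Fx z d20.
have /near[pk Tnear] : norm1 (e0 - k) < dl.
  have dl20 : 0 < dl / 2 by rewrite divr_gt0.
  by have := norm1_sqn dl20 ek; rewrite mulrC divfK.
(* [k + q] is an eigenvector for a real value, hence isotropic, and [q] does not contribute to
   [bform]. *)
have kk : bform dot k k = 0.
  have [Gkq [] kq2] := kq.
  have := (eigen_graph_perp kq).2 _ kq.
  rewrite !bformE (bform_G0 G0q Ek.1) (bform_G0r G0q Ek.1).
  by rewrite (bform_G0 G0q (G0_adj_graph G0q)) !addr0.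
have nu0 : sqn e0 != 0 by rewrite gt_eqF.
pose T := transport e0 p k (sqn e0).
have ET y : D y -> E (T (lift y)).
  move=> Dy; apply: defect_graphB; last exact: defect_graphZ.
  apply: defect_graphD; first exact: defect_graphZ.
  by apply: defect_graphB; [exact: GD|exact: defect_graphZ].
have Dfi i : D (f i).
  by rewrite Df; exact: fam_span_mem.
pose g i := (T (lift (f i))).1.
have gE i : defect_space dot Dc Ac (g i) by apply: defect_graphE; exact: ET.
have lg i : lift (g i) = T (lift (f i)) by apply: lift_fst; exact: (ET _ _).1.
have Tsum b : T (\sum_i b i *: lift (f i)) = \sum_i b i *: lift (g i).
  have Tlin a (y1 y2 : H * H) : T (a *: y1 + y2) = a *: T y1 + T y2 by exact: transport_lin.
  have T0 : T 0 = 0.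
    by have := Tlin (-1) 0 0; rewrite scaler0 addr0 scaleN1r addNr.
  under [RHS]eq_bigr do rewrite lg.
  apply: (big_ind2 (fun x y : H * H => T x = y)) => // [p1 ? p2 ? <- <-|i _].
    by have := Tlin 1 p1 p2; rewrite !scale1r.
  by have := Tlin (b i) (lift (f i)) 0; rewrite T0 !addr0.
have gfree : free_mod [set 0] g.
  move=> b /= bg; apply: ffree => /=.
  have Lf : (lift @` D) (\sum_i b i *: lift (f i)).
    by exists (\sum_i b i *: f i); [rewrite Df; exists b|exact: lift_sum].
  have /(transport_inj D_lag Le0 nu0 e0p pp pk Lf) h :
      T (\sum_i b i *: lift (f i)) = 0.
    rewrite Tsum -lift_sum// bg.
    by apply: (lift_fst (p := 0)); exact: (adj_graph_sub _ _ _).1.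
  by rewrite -[LHS]/((lift (\sum_i b i *: f i)).1) lift_sum// h.
have liftg : lift @` fam_span g = T @` (lift @` D).
  rewrite eqEsubset; split=> [_ [_ [b _ <-] <-]|_ [_ [y Dy <-] <-]].
    exists (\sum_i b i *: lift (f i)); last by rewrite Tsum -lift_sum.
    by exists (\sum_i b i *: f i); [rewrite Df; exists b|exact: lift_sum].
  move: Dy; rewrite Df => -[b _ <-]; exists (\sum_i b i *: g i); first by exists b.
  by rewrite !lift_sum// Tsum.
have Og : Om (fam_span g).
  apply: eO => // i.
  rewrite -[e]ge0_Re ?ltW// normA_lt//; apply: sqn_norm1.
  have -> : (g i - f i, A (g i - f i)) = T (lift (f i)) - lift (f i).
    rewrite -lg -[RHS]lift_fst//; apply: adj_graphB; last exact: (GD _).1.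
    by rewrite lg; exact: (ET _ _).1.
  apply: Tnear.
    by rewrite /B (bigD1 i)//= lerDl sumr_ge0// => j _; exact: norm1_ge0.
  (* Remainders of elements of [L] stay in [L], hence annihilate [e0]: this is the side condition of
     [transport_near]. *)
  apply: D_lag.1 => //; apply: transport_rest_L => //; by exists (f i).
have Ug : U (fam_span g).
  apply: OU; split=> //; split; first exact: OGr.
  apply/selfadjoint_lagrangian; [exact: fam_span_sub|exact: fam_span_defect|].
  rewrite liftg; apply: transport_lagrangian => //; [exact: Ep.1|exact: Ek.1].
exists (fam_span g) => //; exists l%:C; split; last by exists l.
(* In the resolvent set the equation with right side [0] would have a unique solution, so
   [k + q = 0]. Then [k] lies in both [E] and [G0], so it vanishes, against [pk]. *)
move=> [/(_ 0)[y [_ yuniq]] _].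
have kg : (lift @` fam_span g) k.
  rewrite liftg; exists e0 => //; exact: transport_e0.
have kqW : add_space (fam_span g) (Dmin Dc Ac) (k + q).1.
  case: kg => y' gy' <-; exists y' => //; exists q.1 => //; exact: Dmin_G0.
have [Gkq kq2] := kq.
have A0 : A 0 = 0.
  by have := lift_fst (p := 0) (adj_graph_sub _ _ _).1 => /(congr1 snd).
have y0 : y = 0.
  apply: yuniq; split; last by rewrite A0 scaler0 subr0.
  exists 0; first exact: (fam_span_sub g).1.
  by exists 0; [exact: (Dmin_G0 G0_sub.1)|rewrite addr0].
have kq0 : (k + q).1 = 0.
  rewrite -y0; symmetry; apply: yuniq; split=> //.
  have /(congr1 snd) := lift_fst Gkq; rewrite [LHS]/= => ->.
  by rewrite kq2 subrr.
have kq00 : k + q = 0.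
  by rewrite -[LHS]lift_fst// kq0; apply: (lift_fst (p := 0)); exact: (adj_graph_sub _ _ _).1.
have k0 : k = 0.
  apply: defect_graph_G0 => //.
  have -> : k = (-1) *: q by rewrite scaleN1r; apply/eqP; rewrite -addr_eq0 kq00.
  exact: G0Z.
by move: pk; rewrite k0 -(scale0r 0) bformZr rmorph0 mul0r eqxx.
Qed.

(** * Stability when [D] meets the Friedrichs domain only in [Dmin] *)

(* Uniform semiboundedness of all the domains in a conic neighbourhood of [D]. *)
Definition conic_bound (C : R) (D' : set H) := exists2 eta : R, 0 < eta &
  forall x r, D' x -> E r -> norm1 (r - lift x) <= eta * norm1 (lift x) ->
    forall q, G0 q -> - C * rnorm (r.1 + q.1) ^+ 2 <= rdot dot (r.2 + q.2) (r.1 + q.1).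

(** If every constant fails, there are normalized elements of [D] and defect elements ever closer to
    them with energy tending to minus infinity. A cluster point is nonzero, lies in [D + Dmin], and
    belongs to the form domain by [low_energy_form_dom]. *)
Lemma conic_bound_exists :
    ~ (exists u, [/\ add_space D (Dmin Dc Ac) u, friedrichs_dom dot Dc Ac m u &
       ~ Dmin Dc Ac u]) ->
  exists C : R, conic_bound C D.
Proof.
move=> noF; apply: contrapT => noC.
have ex n : exists pr : (H * H) * (H * H), exists q,
    [/\ (lift @` D) pr.1 /\ E pr.2, G0 q,
    norm1 pr.1 = 1, norm1 (pr.2 - pr.1) <= n.+1%:R^-1 &
    rdot dot (pr.2.2 + q.2) (pr.2.1 + q.1) <= - n%:R * rnorm (pr.2.1 + q.1) ^+ 2].
  (* The part [n] of the constant and the aperture [n.+1%:R^-1] come from negating the claim; [|m|]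
     covers the case [x = 0], where only the lower bound on [G0] remains. Otherwise everything is
     rescaled to norm one. *)
  apply: contrapT => nex; apply: noC; exists (n%:R + `|m|).
  exists n.+1%:R^-1; first by rewrite invr_gt0.
  move=> x r Dx Er rx q G0q; rewrite leNgt; apply/negP => low.
  have m0 := normr_ge0 m.
  have [x0|x0] := eqVneq (norm1 (lift x)) 0.
    move: rx; rewrite x0 mulr0 (norm1_eq0 x0) subr0 => r0.
    have {}r0 : r = 0 by apply/norm1_eq0/eqP; rewrite eq_le r0 norm1_ge0.
    move: low; rewrite r0 !add0r; have := G0_rdot_ge G0q.
    have := sqr_ge0 (rnorm q.1); have := ler_norm (- m); rewrite normrN.
    have : 0 <= n%:R :> R by [].
    by move: (n%:R : R) => k *; nra.
  have x_gt0 : 0 < norm1 (lift x) by rewrite lt_neqAle eq_sym x0 norm1_ge0.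
  pose t := (norm1 (lift x))^-1; have t0 : 0 < t by rewrite invr_gt0.
  have ct : cabs t%:C = t by rewrite cabs_real gtr0_norm.
  apply: nex; exists (t%:C *: lift x, t%:C *: r), (t%:C *: q); split=> /=.
  - split; last exact: defect_graphZ.
    by rewrite -[t%:C *: _]addr0; apply: lift_D_sub.2; [exists x|exact: lift_D_sub.1].
  - exact: G0Z.
  - by rewrite norm1Z ct mulVf.
  - rewrite -scalerBr norm1Z ct -ler_pdivlMl// invrK mulrC; exact: rx.
  - rewrite -!scalerDr rdotZl rdotZr rnormZ ct exprMn.
    have := sqr_ge0 (rnorm (r.1 + q.1)); move: low.
    set X := rdot _ _ _; set Y := rnorm _ ^+ 2 => low Y0.
    have -> : t * (t * X) = t ^+ 2 * X by ring.
    rewrite mulrCA ler_wpM2l ?sqr_ge0//; apply: le_trans (ltW low) _.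
    by rewrite ler_wpM2r// lerN2 lerDl.
have [pr prP] := choice ex.
have prL n : (lift @` D) (pr n).1 by case: (prP n) => ? [[]].
have prE n : E (pr n).1 by case: (prL n) => x Dx <-; exact: GD.
have pr1 n : norm1 (pr n).1 = 1 by case: (prP n) => ? [].
have [|p0 [Ep0 clus]] := defect_cluster prE (K := 1).
  move=> n; have := pr1 n; rewrite /norm1 /sqn.
  by have := rnorm_ge0 (pr n).1.1; have := rnorm_ge0 (pr n).1.2; nra.
have p0_neq0 : p0 <> 0.
  move=> p00; have [|n [_ h1 h2]] := clus (1 / 2) 0%N; first by rewrite divr_gt0.
  move: h1 h2; rewrite p00 !sub0r !rnormN; have := pr1 n; rewrite /norm1; lra.
have p0cl : closure (lift @` D) p0.
  apply/closure_rnorm => e e0; have [n [_ h1 h2]] := clus e 0%N e0.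
  by exists (pr n).1.
(* The cluster point lies in the closure of the lift of [D]; isotropy extends to the closure, and
   maximality brings it back to the lift modulo [G0]. *)
have [x Lx|_ [q [[x Dx <-] G0q p0E]]] := D_lag.2 p0 Ep0.1.
  by apply: (bform_closure dot_norm) p0cl => q' Lq'; exact: D_lag.1.
apply: noF; exists p0.1; split.
- by exists x => //; exists q.1; [exact: Dmin_G0|rewrite p0E].
- split; first exact: (Dmax_adj_graph Ep0.1).
  (* The perturbed elements have [norm1] at most [1 + 1], hence [sqn] at most [4]. *)
  apply/friedrichs_form_domP; apply: (@low_energy_form_dom _ 4) => e T e0.
  have e20 : 0 < e / 2 by rewrite divr_gt0.
  have [N1 N1P] := inv_succ_small e20.
  have [n] := clus (e / 2) (maxn N1 (Num.truncn `|T|).+1) e20.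
  rewrite geq_max => -[/andP[/N1P n1 nT] h1 _].
  have [q' [[_ Er] G0q' _ h2 h3]] := prP n.
  exists (pr n).2, q'; split=> //; first exact: Er.1.
  + have : norm1 (pr n).2 <= 2.
      have := norm1D (pr n).1 ((pr n).2 - (pr n).1); rewrite addrC subrK pr1 => h.
      apply: le_trans h _; rewrite -[2]/(1 + 1) lerD2l; apply: le_trans h2 _.
      by rewrite invf_le1// ler1n.
    rewrite /norm1 /sqn; have := rnorm_ge0 (pr n).2.1; have := rnorm_ge0 (pr n).2.2.
    by nra.
  + apply: le_lt_trans (rnorm_subD _ (pr n).1.1 _) _.
    have : rnorm ((pr n).1.1 - (pr n).2.1) <= norm1 ((pr n).2 - (pr n).1).
      by rewrite rnorm_subC /norm1 lerDl rnorm_ge0.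
    by move: (n.+1%:R^-1) n1 h2 => *; lra.
  apply: le_trans h3 _; rewrite ler_wpM2r ?sqr_ge0// lerN2.
  have := truncnS_gt `|T|; have := ler_norm T.
  have : (Num.truncn `|T|).+1%:R <= n%:R :> R by rewrite ler_nat.
  by move: (n%:R : R) (_.+1%:R : R) => *; lra.
- move=> /DminP; rewrite -/(lift _) lift_fst; last exact: Ep0.1.
  by move=> /(defect_graph_G0 Ep0).
Qed.

(** Coefficients are bounded by the norm of the combination, so a small change of frame moves each
    element by a small fraction of its norm. A cone of one third of the aperture around the new span
    then lies in the old cone. *)
Lemma conic_bound_open (C : R) :
  Gr_open dot Dc Ac d [set D' | Gr dot Dc Ac d D' /\ conic_bound C D'].
Proof.
split=> [D' []//|f fF [_ [eta eta0 etaP]]].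
have [K K0 KP] := frame_coef_bound fF.
pose th := Num.min 1 (eta / 3).
have th0 : 0 < th by rewrite lt_min ltr01 divr_gt0.
have th1 : th <= 1 by rewrite ge_min lexx.
have the : th <= eta / 3 by rewrite ge_min lexx orbT.
(* The [2] comes from passing from [sqn] to [norm1]; [d.+1] bounds the number of summands and stays
   positive for [d = 0]. *)
pose e := th / (2 * (K * d.+1%:R)).
have e0 : 0 < e by rewrite divr_gt0// !mulr_gt0.
exists e%:C; first by rewrite ltcR.
move=> g gF gf; split; first exact: frame_Gr.
exists (eta / 3); first by rewrite divr_gt0.
move=> _ r [b _ <-] Er rg q G0q.
have [fE _] := fF; have [gE _] := gF.
apply: (etaP (\sum_i b i *: f i)) => //; first by exists b.
move: rg; rewrite !lift_sum//; set X := \sum_i _; set Y := \sum_i _ => rX.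
have XY : norm1 (X - Y) <= th * norm1 Y.
  rewrite /X /Y -sumrB.
  have gfi i : norm1 (b i *: lift (g i) - b i *: lift (f i)) <= K * norm1 Y * (2 * e).
    rewrite -scalerBr norm1Z ler_pM ?cabs_ge0 ?norm1_ge0//.
    have -> : lift (g i) - lift (f i) = lift (g i - f i).
      symmetry; rewrite -[RHS]lift_fst//; apply: adj_graphB.
        by have /defect_spaceP[] := gE i.
      by have /defect_spaceP[] := fE i.
    by apply/ltW/norm1_sqn => //; rewrite -normA_lt.
  apply: le_trans (norm1_sum gfi) _; rewrite sumr_const card_ord -[_ *+ d]mulr_natr.
  have -> : K * norm1 Y * (2 * e) * d%:R = th * norm1 Y * (d%:R / d.+1%:R).
    by rewrite /e; field; rewrite (gt_eqF K0) addrC natr1 pnatr_eq0.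
  apply: ler_piMr; first exact: mulr_ge0 (ltW th0) (norm1_ge0 _).
  by rewrite ler_pdivrMr// mul1r ler_nat.
have Y0 := norm1_ge0 Y.
have := norm1D (r - X) (X - Y); rewrite addrA subrK.
have := norm1D (X - Y) Y; rewrite subrK => h1 h2.
have h3 : th * norm1 Y <= eta / 3 * norm1 Y by rewrite ler_wpM2r.
have h4 : norm1 X <= 2 * norm1 Y.
  by have : th * norm1 Y <= 1 * norm1 Y; [rewrite ler_wpM2r|lra].
have h5 : eta / 3 * norm1 X <= eta / 3 * (2 * norm1 Y).
  by rewrite ler_wpM2l// divr_ge0// ltW.
by lra.
Qed.

(** Taking [r = lift x] in the conic bound makes [A - l] coercive on the domain with constant
    [- C - l]. A vector orthogonal to its range is, by selfadjointness, an eigenvector in the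
    domain, hence zero, so [coercive_range] solves every equation. *)
Lemma conic_bound_resolvent (C l : R) (D' : set H) :
    SA dot Dc Ac d D' -> conic_bound C D' -> l < - C ->
  resolvent_set (add_space D' (Dmin Dc Ac)) A l%:C.
Proof.
move=> [[D'_sub D'E _] [Wd adjE]] [eta eta0 etaP] lC.
set W := add_space _ _ in Wd adjE *.
pose c := - C - l; have c0 : 0 < c by rewrite /c; lra.
have Wco p : op_graph W A p -> c * rnorm p.1 ^+ 2 <= rdot dot (p.2 - l%:C *: p.1) p.1.
  case: p => _ _ [/= [x Dx [w Dw <-]] ->].
  have Ex : E (lift x) by apply/defect_spaceP; exact: D'E.
  have G0w : G0 (lift w) by apply/DminP.
  have -> : A (x + w) = A x + A w.
    by have := lift_fst (adj_graphD Ex.1 (G0_adj_graph G0w)) => /(congr1 snd).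
  have xx : norm1 (lift x - lift x) <= eta * norm1 (lift x).
    by rewrite subrr {1}/norm1 rnorm0 addr0 mulr_ge0 ?norm1_ge0// ltW.
  have /= h := etaP x (lift x) Dx Ex xx _ G0w.
  by rewrite (rdotDl _ (A x + A w)) rdotNl rdotZl -(rnorm_sqr dot_norm) /c; lra.
have bnd u : W u -> c * rnorm u <= rnorm (A u - l%:C *: u).
  move=> Wu; have [->|u0] := eqVneq (rnorm u) 0; first by rewrite mulr0 rnorm_ge0.
  have u_gt0 : 0 < rnorm u by rewrite lt_neqAle eq_sym u0 rnorm_ge0.
  rewrite -(ler_pM2r u_gt0) -mulrA -expr2.
  by apply: le_trans (Wco (u, A u) _) (rdot_le dot_norm _ _).
have Wlin : linear_subspace (op_graph W A) by rewrite -adjE; exact: adj_graph_sub.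
have Wcl : closure (op_graph W A) `<=` op_graph W A.
  by rewrite -adjE; exact: adj_graph_closed.
split=> [w|].
  have [|p [Wp p2] pw] := coercive_range dot_norm (w := w) Wlin Wcl c0 Wco.
    move=> z zP; have [Wz lz] : op_graph W A (z, l%:C *: z).
      rewrite -adjE => u Wu /=; have := zP (u, A u) (conj Wu erefl).
      by rewrite /= dotBl dotZl dotZr conj_realC => /eqP; rewrite subr_eq0 => /eqP.
    have := bnd z Wz; rewrite -lz subrr rnorm0 => h.
    have z0 : rnorm z = 0 by have := rnorm_ge0 z; nra.
    by rewrite (rnorm_eq0 z0) dot0r.
  exists p.1; split; first by split=> //; rewrite -p2.
  move=> u [Wu uw].
  have : op_graph W A ((-1) *: p + (u, A u)) by apply: Wlin.2; split.
  move=> [Wd1 Ad]; have := bnd _ Wd1; rewrite -Ad/= !scaleN1r => h.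
  have h0 : - p.2 + A u - l%:C *: (- p.1 + u) = 0.
    rewrite scalerDr scalerN opprD opprK addrACA uw.
    by rewrite -[- p.2 + _]opprK opprD opprK pw addNr.
  rewrite h0 rnorm0 in h.
  have z0 : rnorm (- p.1 + u) = 0 by have := rnorm_ge0 (- p.1 + u); nra.
  by move/rnorm_eq0/eqP : z0; rewrite addrC subr_eq0 => /eqP.
exists (c^-1)%:C => u Wu; rewrite -!rnormE -rmorphM lecR ler_pdivlMl//.
exact: bnd.
Qed.

(** The selfadjoint domains sharing the conic bound [C] form a neighbourhood of [D] on which no
    spectrum lies below [- C]. *)
Lemma stable_of_not_friedrichs :
    ~ (exists u, [/\ add_space D (Dmin Dc Ac) u, friedrichs_dom dot Dc Ac m u &
       ~ Dmin Dc Ac u]) ->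
  ~ spectrally_unstable dot Dc Ac d D.
Proof.
move=> noF uns; have [C CD] := conic_bound_exists noF.
pose O : set (set H) := [set D' | Gr dot Dc Ac d D' /\ conic_bound C D'].
have [|D' [[_ CD'] D'SA] [z0 [sp [l lC z0E]]]] := uns (O `&` SA dot Dc Ac d) _ (- C).
  split=> [? []//|]; exists O; first exact: conic_bound_open.
  by split=> //; split=> //; exact: D_SA.1.
by apply: sp; rewrite -z0E; exact: conic_bound_resolvent CD' lC.
Qed.

End Families.

End GraphSpaces.

Theorem theorem1p4 (R : realType) (H : completeNormedModType R[i])
  (dot : {dot H for Num.conj})
  (dot_norm : forall u : H, dot u u = `|u| ^+ 2)
  (separableH : exists S : set H, countable S /\ dense S)
  (Dc : set H) (Ac : H -> H) (m : R)
  (Dc_sub : linear_subspace Dc) (Dc_dense : dense Dc)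
  (Ac_lin : linear_on Dc Ac) (Ac_sym : symmetric_on dot Dc Ac)
  (Ac_below : bounded_below dot Dc Ac m)
  (Dmax_compact : compact_inclusion dot Dc Ac)
  (Dmin_codim : exists n : nat,
    (0 < n)%N /\ quotient_dim (Dmax dot Dc Ac) (Dmin Dc Ac) n)
  (d : nat)
  (d_index : has_index (Dmin Dc Ac) (Amax dot Dc Ac) (- d%:Z))
  (D : set H) (D_SA : SA dot Dc Ac d D) :
  spectrally_unstable dot Dc Ac d D <->
  exists u : H,
    [/\ add_space D (Dmin Dc Ac) u, friedrichs_dom dot Dc Ac m u
      & ~ Dmin Dc Ac u].
Proof.
split=> [unstable|[u [Du Fu nDu]]].
  apply: contrapT => noF.
  by move: unstable; apply: (@stable_of_not_friedrichs R H dot dot_norm Dc Ac m).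
exact: (@friedrichs_unstable R H dot dot_norm Dc Ac m) Fu nDu.
Qed.
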